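(* Let $\vec\ell\in\mathcal W^N_{\mathbb R}$ and $p\in\mathbb C\setminus\{\ell_1,\dots,\ell_N\}$. For $u_1,\dots,u_k,v_1,\dots,v_k\in\mathbb C$ pairwise distinct, $$\frac{\mathcal B_{\vec\ell,p}(u_1,\dots,u_k,0^N/v_1,\dots,v_k)}{\mathcal B_{\vec\ell}(0^N)}=\frac{\prod_{i,j=1}^k(u_i-v_j)}{\prod_{1\le i<j\le k}(u_i-u_j)(v_j-v_i)}\det\Big(\frac1{u_i-v_j}\frac{\mathcal B_{\vec\ell,p}(u_i,0^N/v_j)}{\mathcal B_{\vec\ell}(0^N)}\Big)_{i,j=1}^k.$$ If $u,v\in\mathbb C\setminus\{0\}$ with $u\ne v$, then $$\frac{\mathcal B_{\vec\ell,p}(u,0^N/v)}{\mathcal B_{\vec\ell}(0^N)}=(u-v)\Big(\frac vu\Big)^N\Big(\frac{e^{p(u-v)}}{u-v}+\int_p^\infty dw\oint\frac{dz}{2\pi\mathrm i}\frac1{w-z}\frac{e^{zu}}{e^{wv}}\prod_{i=1}^N\frac{w-\ell_i}{z-\ell_i}\Big),$$ where the $z$-contour is positively oriented around $\ell_1,\dots,\ell_N$, and the $w$-contour is a ray from $p$ to $\infty$ disjoint from the $z$-contour with $\operatorname{Re}(wv)>0$ for $|w|$ large. (When $\vec\ell$ has repeated coordinates, the ratios are understood by continuity in $\vec\ell$.)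
   Context: $\mathcal B_{\vec\ell}(z_1,\dots,z_N)=\det(e^{z_i\ell_j})/\prod_{i<j}(z_i-z_j)$, extended by continuity; $0^N$ denotes $N$ arguments equal to $0$. For $\vec u=(u_1,\dots,u_{N+k})$, $\vec v=(v_1,\dots,v_k)$, $$\mathcal B_{\vec\ell,p}(\vec u/\vec v)=(-1)^{Nk}\frac{\prod_{i,j}(u_i-v_j)}{\prod_{i<j}(u_i-u_j)\prod_{i<j}(v_j-v_i)}\det\Big(\Big(\frac{e^{p(u_i-v_j)}}{u_i-v_j}\Big)_{j\le k}\ \ \big(e^{u_i\ell_j}\big)_{j\le N}\Big)_{i=1}^{N+k},$$ an $(N+k)\times(N+k)$ determinant, extended analytically to all arguments. *)

(* Defs.v *)
From mathcomp Require Import all_boot all_order all_algebra.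
From mathcomp Require Import all_classical all_reals all_analysis.
From mathcomp Require Import complex.

Set Implicit Arguments.
Unset Strict Implicit.
Unset Printing Implicit Defensive.

Import Order.TTheory GRing.Theory Num.Theory.
Local Open Scope ring_scope.
Local Open Scope classical_set_scope.
Local Open Scope complex_scope.

Section BDefs.
Variable R : realType.
Local Notation C := R[i].

Definition expC (z : C) : C :=
  (expR (complex.Re z) * cos (complex.Im z)) +i* (expR (complex.Re z) * sin (complex.Im z)).

Definition vdm (n : nat) (z : 'I_n -> C) : C :=
  \prod_(i < n) \prod_(j < n | (i < j)%N) (z i - z j).

Definition Bl (N : nat) (l : 'I_N -> R) (z : 'I_N -> C) : C :=
  \det (\matrix_(i, j) expC (z i * (l j)%:C)) / vdm z.

Definition Blp (N k : nat) (l : 'I_N -> R) (p : C) (u : 'I_(k + N) -> C)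
    (v : 'I_k -> C) : C :=
  (-1) ^+ (N * k) *
  ((\prod_(i < k + N) \prod_(j < k) (u i - v j)) /
   (vdm u * \prod_(i < k) \prod_(j < k | (i < j)%N) (v j - v i))) *
  \det (\matrix_(i < k + N, j < k + N)
          match fintype.split j with
          | inl j' => expC (p * (u i - v j')) / (u i - v j')
          | inr j' => expC (u i * (l j')%:C)
          end).

(* arguments where the explicit formula for B_{l,p} is non-singular *)
Definition Blp_generic (N k : nat) (u : 'I_(k + N) -> C) (v : 'I_k -> C) :=
  [/\ injective u, injective v & forall i j, u i != v j].

(* "B_l(z0) = L", B_l extended by continuity from distinct arguments *)
Definition Bl_val (N : nat) (l : 'I_N -> R) (z0 : 'I_N -> C) (L : C) :=
  forall eps : R, 0 < eps -> exists2 delta : R, 0 < delta &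
    forall z : 'I_N -> C, injective z ->
      (forall i, `|z i - z0 i| < delta%:C) -> `|Bl l z - L| < eps%:C.

(* "B_{l,p}(u0 / v0) = L", B_{l,p} extended by continuity (= analytically)
   from the generic arguments to all arguments *)
Definition Blp_val (N k : nat) (l : 'I_N -> R) (p : C)
    (u0 : 'I_(k + N) -> C) (v0 : 'I_k -> C) (L : C) :=
  forall eps : R, 0 < eps -> exists2 delta : R, 0 < delta &
    forall (u : 'I_(k + N) -> C) (v : 'I_k -> C), Blp_generic u v ->
      (forall i, `|u i - u0 i| < delta%:C) ->
      (forall j, `|v j - v0 j| < delta%:C) ->
      `|Blp l p u v - L| < eps%:C.

Definition with_zeros (N k : nat) (u : 'I_k -> C) : 'I_(k + N) -> C :=
  fun i => match fintype.split i with inl i' => u i' | inr _ => 0 end.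

(* Weyl chamber W^N_R (non-strict, so repeated coordinates are allowed) *)
Definition weyl (N : nat) (l : 'I_N -> R) :=
  forall i j : 'I_N, (i <= j)%N -> l j <= l i.

(* X = B_{l,p}(u / v) / B_l(0^N)  for l with distinct coordinates *)
Definition ratio_at (N k : nat) (l : 'I_N -> R) (p : C)
    (u : 'I_(k + N) -> C) (v : 'I_k -> C) (X : C) :=
  exists Nm Dn : C, [/\ Blp_val l p u v Nm, Bl_val l (fun _ => 0) Dn,
                        Dn != 0 & X = Nm / Dn].

(* X = B_{l,p}(u / v) / B_l(0^N), understood by continuity in l
   (within W^N_R) when l has repeated coordinates *)
Definition ratio_is (N k : nat) (l : 'I_N -> R) (p : C)
    (u : 'I_(k + N) -> C) (v : 'I_k -> C) (X : C) :=
  (injective l -> ratio_at l p u v X) /\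
  (forall eps : R, 0 < eps -> exists2 delta : R, 0 < delta &
     forall l' : 'I_N -> R, weyl l' -> injective l' ->
       (forall i, `|l' i - l i| < delta) ->
       exists Y, ratio_at l' p u v Y /\ `|Y - X| < eps%:C).

Definition cint (D : set R) (f : R -> C) : C :=
  (Rintegral (@lebesgue_measure R) D (fun t => complex.Re (f t))) +i*
  (Rintegral (@lebesgue_measure R) D (fun t => complex.Im (f t))).

Definition cderiv (g : R -> C) (s : R) : C :=
  (derive1 (fun t => complex.Re (g t)) s) +i* (derive1 (fun t => complex.Im (g t)) s).

Definition contour_int (g : R -> C) (f : C -> C) : C :=
  cint `[0, 1]%classic (fun s => f (g s) * cderiv g s).

Definition C1_loop (g : R -> C) :=
  [/\ g 0 = g 1,
      forall s, s \in `[0, 1] ->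
        derivable (fun t => complex.Re (g t)) s 1 /\ derivable (fun t => complex.Im (g t)) s 1
    & {within `[0, 1]%classic, continuous (derive1 (fun t => complex.Re (g t)))} /\
      {within `[0, 1]%classic, continuous (derive1 (fun t => complex.Im (g t)))}].

(* admissible z-contour: closed C^1 loop, positively oriented (winding number 1)
   around each l_i, and disjoint from the ray {p + t d | t >= 0} *)
Definition admissible_contour (N : nat) (l : 'I_N -> R) (p d : C)
    (g : R -> C) :=
  [/\ C1_loop g,
      forall s i, s \in `[0, 1] -> g s != (l i)%:C,
      forall s (t : R), s \in `[0, 1] -> 0 <= t -> g s != p + t%:C * d
    & forall i, contour_int g (fun z => (z - (l i)%:C)^-1)
                = ((2 * pi)%:C * 'i)].

Definition double_int (N : nat) (l : 'I_N -> R) (p d : C) (g : R -> C)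
    (u v : C) : C :=
  cint `[0, +oo[%classic (fun t =>
    let w := p + t%:C * d in
    d * (((2 * pi)%:C * 'i)^-1 *
         contour_int g (fun z =>
           (w - z)^-1 * (expC (z * u) / expC (w * v)) *
           \prod_(i < N) ((w - (l i)%:C) / (z - (l i)%:C))))).

End BDefs.

(* Main.v *)
Require Import Defs.
From mathcomp Require Import all_boot all_order all_algebra.
From mathcomp Require Import all_classical all_reals all_analysis.
From mathcomp Require Import measurable_realfun complex ring lra.

Set Implicit Arguments.
Unset Strict Implicit.
Unset Printing Implicit Defensive.

Import Order.TTheory GRing.Theory Num.Theory.
Import numFieldNormedType.Exports.
Import Normc.
Local Open Scope ring_scope.
Local Open Scope classical_set_scope.
Local Open Scope complex_scope.

(** Multiplying the rows of the [k = 1] matrix by [u_i - v] makes all its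
    entries entire, so the Newton factorizations in the [u_i] and in the [l_j]
    split off both Vandermonde determinants and leave a determinant of divided
    differences, given by power series that are continuous in all arguments,
    repeated ones included.  At [(u, 0^N)] row and column operations evaluate
    this determinant in terms of the Newton interpolant [P] of [exp(u y)] at the
    nodes [l] and the solution [Q] of [v Q - Q' = P], which is what integrating
    [P(w) exp(- w v)] along the ray produces.  The inner contour integral equals
    [P(w) exp(- w v)]: telescoping [prod (w - l_i) / (z - l_i)] leaves
    divided-difference integrals and [exp(z u) / (w - z)], whose integral vanishes
    because the ray cuts out a branch of the logarithm.  The case of general [k]
    follows from [k = 1] by taking the Schur complement of the block
    [exp(y_i l_j)], at nodes [y] close to [0^N]. *)

(** Numerator and denominator of the ratio are 0/0 limits, in the arguments at 0^N and, for the
    quotient itself, at repeated coordinates of [l]. Both determinants carry the factor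
    [sgm N * \det (nmx N lc)], which vanishes exactly when coordinates of [l] repeat. It cancels in
    the quotient, and the remaining [rat] is defined and continuous for every [l], so one function
    answers both clauses of [ratio_is]. The limits range over all nearby generic arguments, which is
    why every series is controlled by a bound M r^m / m! that is uniform over a neighbourhood. The
    loop is a general C^1 loop, known through its integrals of 1/(z - l_i) and its avoidance of the
    ray. Hence integrands are reduced by algebra to these inverse poles and to functions that have a
    primitive along the loop. The exponential is integrated termwise, which turns its contour
    integrals into the same divided differences of monomials [ddm] that occur in the
    determinants. *)

Section DividedDifferences.
Variable K : comNzRingType.
Implicit Types (x : nat -> K) (m q n i : nat).

(* The divided difference of [X^m] at the nodes [x 0, ..., x q]. *)
Fixpoint ddm x m q : K :=
  if m is m'.+1 then (if q is q'.+1 then ddm x m' q' else 0) + x q * ddm x m' q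
  else (q == 0%N)%:R.

Definition newton x q (y : K) : K := \prod_(s < q) (y - x s).

Lemma ddm_gt x m q : (m < q)%N -> ddm x m q = 0.
Proof.
elim: m q => [|m IH] [|q] //= mq.
by rewrite IH // IH ?mulr0 ?addr0 //; apply: ltn_trans mq.
Qed.

Lemma ddm_diag x m : ddm x m m = 1.
Proof. by elim: m => [|m IH] //=; rewrite IH ddm_gt // mulr0 addr0. Qed.

Section NewtonStep.
Variables (A : comNzRingType) (f : {rmorphism K -> A}) (y : A).

(** The defect [W n.+1 * f (ddm x m n)] dies for two reasons, hence the two expansions below: if
    [m < n] the divided difference is zero and [y] is arbitrary; if [y] is a node, [W n.+1] has a
    zero factor and [m] is arbitrary. The morphism [f] allows [y] to be the indeterminate ['X]. *)
Lemma newton_step x m n (W := fun q => \prod_(s < q) (y - f (x s))) :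
  \sum_(q < n.+1) W q * f (ddm x m.+1 q) =
  y * (\sum_(q < n.+1) W q * f (ddm x m q)) - W n.+1 * f (ddm x m n).
Proof.
have WS q : W q.+1 = W q * (y - f (x q)) by rewrite /W big_ord_recr.
elim: n => [|n IH].
  by rewrite !big_ord1 /= WS add0r rmorphM /=; ring.
rewrite big_ord_recr IH [in RHS]big_ord_recr /= !WS !rmorphD !rmorphM /=.
by ring.
Qed.

Lemma newton_poly x m n : (m < n)%N ->
  y ^+ m = \sum_(q < n) (\prod_(s < q) (y - f (x s))) * f (ddm x m q).
Proof.
case: n => // n; elim: m => [|m IH] mn.
  rewrite big_ord_recl /= big_ord0 rmorph1 mulr1 big1 ?addr0 // => i _.
  by rewrite rmorph0 mulr0.
by rewrite newton_step -IH ?(ltnW mn) // ddm_gt // rmorph0 mulr0 subr0 exprS.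
Qed.

Lemma newton_node x m n i : (i < n)%N -> y = f (x i) ->
  y ^+ m = \sum_(q < n) (\prod_(s < q) (y - f (x s))) * f (ddm x m q).
Proof.
case: n => // n lin yi; elim: m => [|m IH].
  rewrite big_ord_recl /= big_ord0 rmorph1 mulr1 big1 ?addr0 // => j _.
  by rewrite rmorph0 mulr0.
rewrite newton_step -IH // (bigD1 (Ordinal lin)) //= yi subrr !mul0r subr0.
by rewrite exprS.
Qed.
End NewtonStep.

Lemma newton_nodeE x m n i : (i < n)%N ->
  x i ^+ m = \sum_(q < n) newton x q (x i) * ddm x m q.
Proof. by move=> lin; apply: (newton_node (f := idfun) _ lin). Qed.

Lemma newton_mx_det x n :
  \det (\matrix_(i < n, q < n) newton x q (x i)) = \prod_(i < n) newton x i (x i).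
Proof.
rewrite det_trig; first by apply: eq_bigr => i _; rewrite mxE.
apply/is_trig_mxP => i q iq; rewrite mxE /newton.
by rewrite (bigD1 (Ordinal iq)) //= subrr mul0r.
Qed.

Lemma prod_gt_newton x n :
  \prod_(i < n) \prod_(j < n | (i < j)%N) (x i - x j) =
  (\prod_(j < n) (-1) ^+ j) * \prod_(i < n) newton x i (x i).
Proof.
rewrite (exchange_big_dep predT) //= -big_split /=; apply: eq_bigr => j _.
rewrite /newton -[X in (-1) ^+ X]card_ord -prodr_const -big_split /=.
rewrite -(big_mkord (fun i => (i < j)%N) (fun i => x i - x j)).
rewrite (big_cat_nat (n := j)) //= ?(ltnW (ltn_ord j)) //.
rewrite [X in _ * X]big_nat_cond [X in _ * X]big_pred0; last first.
  by move=> i; case: (leqP j i); rewrite /= ?andbF.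
rewrite mulr1 big_nat_cond (eq_bigl (fun i => (0 <= i < j)%N)); last first.
  by move=> i /=; case: ltnP; rewrite ?andbF.
rewrite -big_nat big_mkord; apply: eq_bigr => s _; ring.
Qed.

(* [S P = sum_i P^(i) / v^(i+1)], with [c = 1/v], inverts [P |-> v P - P']. *)
Definition antider (c : K) n (P : {poly K}) : {poly K} :=
  \sum_(i < n) c ^+ i.+1 *: derivn i P.

(** The sum telescopes: [k] terms give P - c^k P^(k), and the [n]-th derivative is zero once [n]
    bounds the size of [P]. *)
Lemma antiderP (c v : K) n (P : {poly K}) : v * c = 1 -> (size P <= n)%N ->
  v *: antider c n P - deriv (antider c n P) = P.
Proof.
move=> vc sP.
suff -> k : v *: antider c k P - deriv (antider c k P) = P - c ^+ k *: derivn k P.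
  suff -> : derivn n P = 0 by rewrite scaler0 subr0.
  by apply/polyP => i; rewrite coef_derivn nth_default ?mul0rn ?coef0 // (leq_trans sP) ?leq_addr.
elim: k => [|k IH]; rewrite /antider.
  by rewrite big_ord0 scaler0 deriv0 expr0 scale1r derivn0 !subrr.
rewrite big_ord_recr /= -/(antider c k P) scalerDr derivD opprD addrACA IH.
rewrite scalerA exprS mulrA vc mul1r derivZ -derivnS.
by rewrite addrA subrK.
Qed.

Lemma antider_deriv c n (P : {poly K}) : deriv (antider c n P) = antider c n (deriv P).
Proof.
rewrite /antider linear_sum /=; apply: eq_bigr => i _.
by rewrite derivZ -derivnS derivSn.
Qed.

Lemma antiderZ c n a (P : {poly K}) : antider c n (a *: P) = a *: antider c n P.
Proof.
rewrite /antider scaler_sumr; apply: eq_bigr => i _.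
by rewrite derivnZ !scalerA mulrC.
Qed.

Lemma antider_sum c n m (F : 'I_m -> {poly K}) :
  antider c n (\sum_q F q) = \sum_q antider c n (F q).
Proof.
rewrite /antider exchange_big /=; apply: eq_bigr => i _.
by rewrite linear_sum -scaler_sumr.
Qed.

Definition newtonP x q : {poly K} := \prod_(s < q) ('X - (x s)%:P).

Lemma newtonP_horner x q y : (newtonP x q).[y] = newton x q y.
Proof. by rewrite /newtonP horner_prod; apply: eq_bigr => s _; rewrite !hornerE. Qed.

Lemma size_newtonP x q : size (newtonP x q) = q.+1.
Proof.
by rewrite /newtonP size_prod_XsubC /index_enum -enumT size_enum_ord.
Qed.

Lemma XnE_newtonP x m n : (m < n)%N ->
  'X^m = \sum_(q < n) ddm x m q *: newtonP x q.
Proof.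
move=> mn; rewrite (newton_poly polyC _ x mn).
by apply: eq_bigr => q _; rewrite mulrC mul_polyC.
Qed.

(* Applying [S (v - d/dX) = 1] to [X^i], expanded in the Newton basis. *)
Lemma antider_newtonP x (c v y : K) n i : v * c = 1 -> (i < n)%N ->
  \sum_(q < n) (v * ddm x i q - i%:R * ddm x i.-1 q) *
     (antider c n (newtonP x q)).[y] = y ^+ i.
Proof.
move=> vc lin.
have sX : (size ('X^i : {poly K}) <= n)%N by rewrite size_polyXn.
have := antiderP vc sX; rewrite antider_deriv derivXn => /(congr1 (horner^~ y)).
rewrite hornerXn => <-.
have -> : v *: antider c n 'X^i - antider c n ('X^(i.-1) *+ i) =
    \sum_(q < n) (v * ddm x i q - i%:R * ddm x i.-1 q) *: antider c n (newtonP x q).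
  rewrite -scaler_nat antiderZ.
  have E m : (m < n)%N -> antider c n 'X^m = \sum_(q < n) ddm x m q *: antider c n (newtonP x q).
    move=> mn; rewrite (XnE_newtonP x mn) antider_sum.
    by apply: eq_bigr => q _; rewrite antiderZ.
  rewrite !E // ?(leq_ltn_trans (leq_pred i)) // !scaler_sumr -sumrB.
  by apply: eq_bigr => q _; rewrite !scalerA scalerBl.
rewrite -horner_evalE linear_sum /=.
by apply: eq_bigr => q _; rewrite horner_evalE hornerZ.
Qed.

End DividedDifferences.

Local Arguments normc : simpl never.

(** * Componentwise complex limits and dominated complex series *)

Section ComplexLimits.
Variable R : realType.
Local Notation C := R[i].
Local Notation Re := (@complex.Re R).
Local Notation Im := (@complex.Im R).
Implicit Types z w : C.

Lemma norm_normc z : `|z| = (normc z)%:C. Proof. by case: z. Qed.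

Lemma normc_lt z (e : R) : (`|z| < e%:C) = (normc z < e).
Proof. by rewrite norm_normc ltcR. Qed.

Lemma normc_ge0 z : 0 <= normc z. Proof. by case: z => a b; apply: sqrtr_ge0. Qed.

Lemma normc_sqrt z : normc z = Num.sqrt (Re z ^+ 2 + Im z ^+ 2).
Proof. by case: z. Qed.

Lemma normc_ReIm z : normc z <= `|Re z| + `|Im z|.
Proof.
rewrite normc_sqrt -[leRHS]ger0_norm ?addr_ge0 // -sqrtr_sqr ler_wsqrtr //.
by rewrite -(real_normK (num_real (Re z))) -(real_normK (num_real (Im z)))
  sqrrD lerD2r lerDl mulrn_wge0 // mulr_ge0.
Qed.

Lemma Re_normc z : `|Re z| <= normc z.
Proof. by rewrite normc_sqrt -sqrtr_sqr ler_wsqrtr // lerDl sqr_ge0. Qed.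

Lemma Im_normc z : `|Im z| <= normc z.
Proof. by rewrite normc_sqrt -sqrtr_sqr ler_wsqrtr // lerDr sqr_ge0. Qed.

Lemma normcD z w : normc (z + w) <= normc z + normc w.
Proof. exact: le_normcD. Qed.

Lemma normcNE z : normc (- z) = normc z.
Proof. exact: normcN. Qed.

Lemma normcB z w : normc (z - w) = normc (w - z).
Proof. by rewrite -normcNE opprB. Qed.

Lemma normc_real (x : R) : normc x%:C = `|x|.
Proof. by rewrite normc_sqrt /= expr0n addr0 sqrtr_sqr. Qed.

Lemma normcX z n : normc (z ^+ n) = normc z ^+ n.
Proof. by elim: n => [|n IH]; rewrite ?normc1 // !exprS normcM IH. Qed.

Lemma normc_sum n (f : 'I_n -> C) : normc (\sum_i f i) <= \sum_i normc (f i).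
Proof.
elim/big_ind2: _ => [|x a y b xa yb|//]; first by rewrite normc0.
exact: le_trans (normcD _ _) (lerD xa yb).
Qed.

Lemma normc_eq0 z : (normc z == 0) = (z == 0).
Proof. by apply/eqP/eqP => [/eq0_normc//|->]; rewrite normc0. Qed.

Lemma ReD z w : Re (z + w) = Re z + Re w. Proof. by case: z; case: w. Qed.
Lemma ImD z w : Im (z + w) = Im z + Im w. Proof. by case: z; case: w. Qed.
Lemma ReN z : Re (- z) = - Re z. Proof. by case: z. Qed.
Lemma ImN z : Im (- z) = - Im z. Proof. by case: z. Qed.
Lemma ReM z w : Re (z * w) = Re z * Re w - Im z * Im w.
Proof. by case: z; case: w. Qed.
Lemma ImM z w : Im (z * w) = Re z * Im w + Im z * Re w.
Proof. by case: z; case: w. Qed.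

Lemma Re_sum I (r : seq I) (P : pred I) (f : I -> C) :
  Re (\sum_(i <- r | P i) f i) = \sum_(i <- r | P i) Re (f i).
Proof. by apply: (big_morph Re ReD). Qed.
Lemma Im_sum I (r : seq I) (P : pred I) (f : I -> C) :
  Im (\sum_(i <- r | P i) f i) = \sum_(i <- r | P i) Im (f i).
Proof. by apply: (big_morph Im ImD). Qed.

(** Componentwise, so that results on real limits apply at once; [ctendsP] recovers the form with
    the modulus. *)
Definition ctends (T : Type) (F : set_system T) (f : T -> C) (L : C) :=
  (Re (f x) @[x --> F] --> Re L) /\ (Im (f x) @[x --> F] --> Im L).

Section Tends.
Variables (T : Type) (F : set_system T) (FF : Filter F).
Implicit Types f g : T -> C.

Lemma ctendsP f L : ctends F f L <->
  forall e : R, 0 < e -> \forall x \near F, normc (f x - L) < e.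
Proof.
split=> [[fr fi] e e0|H].
  have e2 : 0 < e / 2 by rewrite divr_gt0.
  have {}fr : \forall x \near F, `|Re L - Re (f x)| < e / 2 by move/cvgrPdist_lt: fr; apply.
  have {}fi : \forall x \near F, `|Im L - Im (f x)| < e / 2 by move/cvgrPdist_lt: fi; apply.
  near=> x; apply: le_lt_trans (normc_ReIm _) _.
  rewrite ReD ReN ImD ImN [ltRHS]splitr ltrD // distrC; near: x; [exact: fr|exact: fi].
split; apply/cvgrPdist_lt => e e0; near=> x; rewrite distrC.
  rewrite -ReN -ReD; apply: le_lt_trans (Re_normc _) _; near: x; exact: H.
rewrite -ImN -ImD; apply: le_lt_trans (Im_normc _) _; near: x; exact: H.
Unshelve. all: by end_near. Qed.

Lemma ctends_cst c : ctends F (fun=> c) c.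
Proof. by split; apply: cvg_cst. Qed.

Lemma ctendsD f g a b : ctends F f a -> ctends F g b ->
  ctends F (fun x => f x + g x) (a + b).
Proof.
move=> [fr fi] [gr gi]; split.
  by rewrite ReD; under eq_fun do rewrite ReD; apply: cvgD.
by rewrite ImD; under eq_fun do rewrite ImD; apply: cvgD.
Qed.

Lemma ctendsN f a : ctends F f a -> ctends F (fun x => - f x) (- a).
Proof.
move=> [fr fi]; split.
  by rewrite ReN; under eq_fun do rewrite ReN; apply: cvgN.
by rewrite ImN; under eq_fun do rewrite ImN; apply: cvgN.
Qed.

Lemma ctendsB f g a b : ctends F f a -> ctends F g b ->
  ctends F (fun x => f x - g x) (a - b).
Proof. by move=> fa gb; apply: ctendsD => //; apply: ctendsN. Qed.

Lemma ctendsM f g a b : ctends F f a -> ctends F g b ->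
  ctends F (fun x => f x * g x) (a * b).
Proof.
move=> [fr fi] [gr gi]; split.
  by rewrite ReM; under eq_fun do rewrite ReM; apply: cvgB; apply: cvgM.
by rewrite ImM; under eq_fun do rewrite ImM; apply: cvgD; apply: cvgM.
Qed.

Lemma ctendsV f a : a != 0 -> ctends F f a -> ctends F (fun x => (f x)^-1) a^-1.
Proof.
have ReV z : Re z^-1 = Re z / (Re z ^+ 2 + Im z ^+ 2) by case: z.
have ImV z : Im z^-1 = - Im z / (Re z ^+ 2 + Im z ^+ 2) by case: z => u v; rewrite /= mulNr.
move=> a0 [fr fi].
have n0 : Re a ^+ 2 + Im a ^+ 2 != 0.
  apply: contra a0; case: a {fr fi} => x y /=.
  by rewrite paddr_eq0 ?sqr_ge0 // !sqrf_eq0 => /andP[/eqP-> /eqP->].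
have n2 : (Re (f x) ^+ 2 + Im (f x) ^+ 2)^-1 @[x --> F] --> (Re a ^+ 2 + Im a ^+ 2)^-1.
  by apply: cvgV => //; apply: cvgD; rewrite expr2; under eq_fun do rewrite expr2; apply: cvgM.
split.
  by rewrite ReV; under eq_fun do rewrite ReV; apply: cvgM.
by rewrite ImV; under eq_fun do rewrite ImV; apply: cvgM => //; apply: cvgN.
Qed.

Lemma ctends_sum (I : Type) (r : seq I) (P : pred I) (f : I -> T -> C) (a : I -> C) :
  (forall i, P i -> ctends F (f i) (a i)) ->
  ctends F (fun x => \sum_(i <- r | P i) f i x) (\sum_(i <- r | P i) a i).
Proof.
move=> fa; elim: r => [|i r IH].
  by rewrite big_nil; under eq_fun do rewrite big_nil; apply: ctends_cst.
rewrite big_cons; under eq_fun do rewrite big_cons.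
by case: ifP => // Pi; apply: ctendsD => //; apply: fa.
Qed.

Lemma ctends_prod (I : Type) (r : seq I) (P : pred I) (f : I -> T -> C) (a : I -> C) :
  (forall i, P i -> ctends F (f i) (a i)) ->
  ctends F (fun x => \prod_(i <- r | P i) f i x) (\prod_(i <- r | P i) a i).
Proof.
move=> fa; elim: r => [|i r IH].
  by rewrite big_nil; under eq_fun do rewrite big_nil; apply: ctends_cst.
rewrite big_cons; under eq_fun do rewrite big_cons.
by case: ifP => // Pi; apply: ctendsM => //; apply: fa.
Qed.

Lemma ctends_det n (A : T -> 'M[C]_n) (B : 'M[C]_n) :
  (forall i j, ctends F (fun x => A x i j) (B i j)) ->
  ctends F (fun x => \det (A x)) (\det B).
Proof.
move=> AB; rewrite /determinant; apply: ctends_sum => s _.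
apply: ctendsM; first exact: ctends_cst.
by apply: ctends_prod => i _; apply: AB.
Qed.

Lemma ctends_near_eq f g a : (\forall x \near F, f x = g x) ->
  ctends F f a -> ctends F g a.
Proof.
move=> fg /ctendsP fa; apply/ctendsP => e e0; near=> x.
have <- : f x = g x by near: x.
by near: x; apply: fa.
Unshelve. all: by end_near. Qed.

Lemma ctends_neq0 f a : a != 0 -> ctends F f a -> \forall x \near F, f x != 0.
Proof.
move=> a0 /ctendsP fa; have : 0 < normc a by rewrite lt_def normc_ge0 normc_eq0 a0.
move=> /fa; apply: filterS => x; apply: contraTN => /eqP->.
by rewrite sub0r normcNE ltxx.
Qed.

Lemma ctends_ddm (x : T -> nat -> C) x0 m q :
  (forall s, (s <= q)%N -> ctends F (x^~ s) (x0 s)) ->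
  ctends F (fun t => ddm (x t) m q) (ddm x0 m q).
Proof.
elim: m q => [|m IH] q H /=; first exact: ctends_cst.
apply: ctendsD; last by apply: ctendsM; [exact: H|exact: IH].
case: q H => [|q] H; first exact: ctends_cst.
by apply: IH => s /leqW; apply: H.
Qed.

(** Supplies one radius valid along the whole filter, as the domination of the kernel series
    requires; [1 <= rho] is the form expected by [normc_ddm]. *)
Lemma ctends_bounded n (x : T -> nat -> C) x0 :
  (forall s, (s < n)%N -> ctends F (x^~ s) (x0 s)) ->
  exists2 rho : R, 1 <= rho & (forall s, (s < n)%N -> normc (x0 s) <= rho) /\
    \forall t \near F, forall s, (s < n)%N -> normc (x t s) <= rho.
Proof.
elim: n => [|n IH] H; first by exists 1 => //; split=> //; near=> t.
have [s sn|rho r1 [h0 h]] := IH; first by apply: H; rewrite ltnS ltnW.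
exists (rho + normc (x0 n)); first by rewrite ler_wpDr // normc_ge0.
split.
  move=> s; rewrite ltnS leq_eqVlt => /orP[/eqP->|sn].
    by rewrite lerDr (le_trans ler01).
  by rewrite ler_wpDr ?normc_ge0 // h0.
have /ctendsP/(_ 1 ltr01) := H n (ltnSn n).
move: h; apply: filterS2 => t h hn s; rewrite ltnS leq_eqVlt => /orP[/eqP->|sn].
  rewrite -[x t n](subrK (x0 n)); apply: le_trans (normcD _ _) _.
  by rewrite lerD2r; apply: le_trans (ltW hn) r1.
by rewrite ler_wpDr ?normc_ge0 // h.
Unshelve. all: by end_near. Qed.

End Tends.

Lemma ctends_comp (T U : Type) (F : set_system T) (G : set_system U) (FF : Filter F)
  (FG : Filter G) (phi : T -> U) f L :
  phi x @[x --> F] `=>` G -> ctends G f L -> ctends F (f \o phi) L.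
Proof.
by move=> H [fr fi]; split; [apply: (cvg_comp phi (fun x => Re (f x)) H fr)
  |apply: (cvg_comp phi (fun x => Im (f x)) H fi)].
Qed.

Lemma ctends_normc_le (T : Type) (F : set_system T) (FF : ProperFilter F) f a c (B : R) :
  ctends F f a -> (\forall x \near F, normc (f x - c) <= B) -> normc (a - c) <= B.
Proof.
move=> /ctendsP fa fB; apply/ler_addgt0Pr => e /fa fae.
have [x [x1 x2]] := filter_ex (filterI fB fae).
have -> : a - c = (a - f x) + (f x - c) by ring.
rewrite addrC; apply: le_trans (normcD _ _) (lerD x1 _).
by rewrite normcB ltW.
Qed.

(** Each step of the recurrence produces at most two terms, whence 2^m; [1 <= rho] lets rho^m also
    absorb the term that gains no factor [x q]. *)
Lemma normc_ddm (x : nat -> C) (rho : R) m q : 1 <= rho ->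
  (forall s, (s <= q)%N -> normc (x s) <= rho) -> normc (ddm x m q) <= (2 * rho) ^+ m.
Proof.
move=> r1; have r0 : 0 <= rho := le_trans ler01 r1.
elim: m q => [|m IH] q H.
  by rewrite /=; case: q {H} => [|q]; rewrite ?normc1 ?normc0.
have -> : ddm x m.+1 q = (if q is q'.+1 then ddm x m q' else 0) + x q * ddm x m q by [].
have -> : (2 * rho) ^+ m.+1 = rho * (2 * rho) ^+ m + rho * (2 * rho) ^+ m.
  by rewrite exprS; ring.
apply: le_trans (normcD _ _) _; rewrite normcM lerD //.
  apply: (@le_trans _ _ ((2 * rho) ^+ m)); last by rewrite ler_peMl // exprn_ge0 ?mulr_ge0.
  case: q H => [|q] H; first by rewrite normc0 exprn_ge0 ?mulr_ge0.
  by apply: IH => s /leqW; apply: H.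
by apply: ler_pM; rewrite ?normc_ge0 //; [exact: H|exact: IH].
Qed.

Definition has_csum (a : nat -> C) (L : C) :=
  ctends \oo (fun n => \sum_(m < n) a m) L.

Definition csum (a : nat -> C) : C :=
  limn (series (fun m => Re (a m))) +i* limn (series (fun m => Im (a m))).

Arguments csum : simpl never.

Definition ebnd (M r : R) (a : nat -> C) := forall m, normc (a m) <= M * exp_coeff r m.

Lemma has_csumE a L : has_csum a L -> csum a = L.
Proof.
move=> [hr hi]; case: L hr hi => x y /= hr hi; rewrite /csum; congr (_ +i* _).
  apply/cvg_lim => //; suff -> : series (fun m => Re (a m)) = fun n => Re (\sum_(m < n) a m) by [].
  by apply/funext => n; rewrite seriesEord /= Re_sum.
apply/cvg_lim => //; suff -> : series (fun m => Im (a m)) = fun n => Im (\sum_(m < n) a m) by [].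
by apply/funext => n; rewrite seriesEord /= Im_sum.
Qed.

Lemma ebnd_has_csum M r a : ebnd M r a -> has_csum a (csum a).
Proof.
move=> aM.
have H (f : C -> R) : (forall z, `|f z| <= normc z) -> cvgn (series (fun m => f (a m))).
  move=> fn; apply: normed_cvg.
  apply: (@series_le_cvg _ _ (M *: exp_coeff r)) => [m|m|m|] //=.
  - exact: le_trans (normc_ge0 _) (aM m).
  - exact: le_trans (fn _) (aM m).
  - by apply: is_cvg_seriesZ; apply: is_cvg_series_exp_coeff.
split; rewrite /csum /=.
  suff -> : (fun n => Re (\sum_(m < n) a m)) = series (fun m => Re (a m)) by exact: H Re_normc.
  by apply/funext => n; rewrite seriesEord Re_sum.
suff -> : (fun n => Im (\sum_(m < n) a m)) = series (fun m => Im (a m)) by exact: H Im_normc.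
by apply/funext => n; rewrite seriesEord Im_sum.
Qed.

(** The majorant is [M] times the exponential series, so the remainder [T] depends on [M] and [r]
    alone and one truncation order serves a whole family of series. *)
Lemma ebnd_tail M r : exists2 T : nat -> R, T @ \oo --> 0 &
  forall a, ebnd M r a -> forall n, normc (csum a - \sum_(m < n) a m) <= T n.
Proof.
have cS : series (M *: exp_coeff r) @ \oo --> limn (series (M *: exp_coeff r)).
  by apply: is_cvg_seriesZ; apply: is_cvg_series_exp_coeff.
set S := limn _ in cS.
exists (fun n => S - series (M *: exp_coeff r) n).
  by rewrite -(subrr S); apply: cvgB => //; apply: cvg_cst.
move=> a aM n.
have e0 m : 0 <= (M *: exp_coeff r) m by exact: le_trans (normc_ge0 _) (aM m).
have nd : nondecreasing_seq (series (M *: exp_coeff r)).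
  by apply: nondecreasing_series => m _ _; apply: e0.
have := ebnd_has_csum aM; rewrite /has_csum => /ctends_normc_le; apply; near=> k.
have nk : (n <= k)%N by near: k; exists n.
rewrite -(big_mkord predT) (big_cat_nat (n := n)) //= big_mkord addrAC subrr add0r.
have sh (V : nmodType) (h : nat -> V) :
    \sum_(n <= m < k) h m = \sum_(m < k - n) h (m + n)%N.
  by rewrite -{1}[n]add0n big_addn big_mkord.
rewrite sh; apply: le_trans (normc_sum _) _.
apply: (@le_trans _ _ (series (M *: exp_coeff r) k - series (M *: exp_coeff r) n)).
  rewrite sub_series_geq // sh.
  by apply: ler_sum => m _; apply: aM.
by rewrite lerD2r; apply: nondecreasing_cvgn_le => //; apply/cvg_ex; exists S.
Unshelve. all: by end_near. Qed.

(** Dominated convergence for series: a common truncation leaves two tails and one difference of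
    finite sums, each below [e / 4]. *)
Lemma ctends_csum (T : Type) (F : set_system T) (FF : Filter F) (a : T -> nat -> C) b M r :
  ebnd M r b -> (\forall x \near F, ebnd M r (a x)) ->
  (forall m, ctends F (a^~ m) (b m)) ->
  ctends F (fun x => csum (a x)) (csum b).
Proof.
move=> bM aM ab; have [t t0 tail] := ebnd_tail M r.
apply/ctendsP => e e0; have e4 : 0 < e / 4 by rewrite divr_gt0.
move/cvgrPdist_lt: t0 => /(_ _ e4) [n _ /(_ n (leqnn n))] /=.
rewrite sub0r normrN => tn; have {}tn : t n < e / 4 by apply: le_lt_trans (ler_norm _) tn.
have /ctendsP/(_ _ e4) : ctends F (fun x => \sum_(m < n) a x m) (\sum_(m < n) b m).
  by apply: ctends_sum => m _; apply: ab.
move: aM; apply: filterS2 => x aM h.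
have -> : csum (a x) - csum b = (csum (a x) - \sum_(m < n) a x m) +
   ((\sum_(m < n) a x m - \sum_(m < n) b m) - (csum b - \sum_(m < n) b m)) by ring.
apply: le_lt_trans (normcD _ _) _; have := normcD (\sum_(m < n) a x m - \sum_(m < n) b m)
  (- (csum b - \sum_(m < n) b m)); rewrite normcNE.
have := tail _ aM n; have := tail _ bM n; lra.
Qed.

Lemma has_csum_sum n (c : 'I_n -> C) (a : 'I_n -> nat -> C) L :
  (forall q, has_csum (a q) (L q)) ->
  has_csum (fun m => \sum_q c q * a q m) (\sum_q c q * L q).
Proof.
move=> aL; rewrite /has_csum; under eq_fun do rewrite exchange_big /=.
under eq_fun do under eq_bigr do rewrite -mulr_sumr.
by apply: ctends_sum => q _; apply: ctendsM; [exact: ctends_cst|exact: aL].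
Qed.

Lemma has_csumZ c a L : has_csum a L -> has_csum (fun m => c * a m) (c * L).
Proof.
move=> aL; rewrite /has_csum; under eq_fun do rewrite -mulr_sumr.
by apply: ctendsM => //; apply: ctends_cst.
Qed.

Lemma has_csumD a b A B : has_csum a A -> has_csum b B ->
  has_csum (fun m => a m + b m) (A + B).
Proof.
move=> aA bB; rewrite /has_csum; under eq_fun do rewrite big_split /=.
exact: ctendsD.
Qed.

Lemma has_csum1 (a : nat -> C) k : (forall m, m != k -> a m = 0) -> has_csum a (a k).
Proof.
move=> a0; apply: (@ctends_near_eq _ _ _ (fun=> a k)); last exact: ctends_cst.
near=> n; have kn : (k < n)%N by near: n; exists k.+1.
by rewrite (bigD1 (Ordinal kn)) //= big1 ?addr0 // => i ik; rewrite a0.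
Unshelve. all: by end_near. Qed.

End ComplexLimits.

(** * Complex-valued functions of a real parameter: derivatives and the exponential series *)

Section ComplexDerivative.
Variable R : realType.
Local Notation C := R[i].
Local Notation Re := (@complex.Re R).
Local Notation Im := (@complex.Im R).
Implicit Types (f g : R -> C) (s t : R).

Definition is_cder f s (D : C) :=
  is_derive s 1 (fun t => Re (f t)) (Re D) /\ is_derive s 1 (fun t => Im (f t)) (Im D).

Lemma is_cder_eq f s D E : is_cder f s D -> D = E -> is_cder f s E.
Proof. by move=> h <-. Qed.

Lemma is_cder_cst c s : is_cder (fun=> c) s 0.
Proof. by split; apply: is_derive_cst. Qed.

Lemma is_cder_id s : is_cder (fun t => t%:C) s 1.
Proof. by split; [apply: is_derive_id|apply: is_derive_cst]. Qed.

Lemma is_cderD f g s D E : is_cder f s D -> is_cder g s E ->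
  is_cder (fun t => f t + g t) s (D + E).
Proof.
move=> [fr fi] [gr gi]; split.
  by rewrite ReD; under eq_fun do rewrite ReD; apply: is_deriveD.
by rewrite ImD; under eq_fun do rewrite ImD; apply: is_deriveD.
Qed.

Lemma is_cderN f s D : is_cder f s D -> is_cder (fun t => - f t) s (- D).
Proof.
move=> [fr fi]; split.
  by rewrite ReN; under eq_fun do rewrite ReN; apply: is_deriveN.
by rewrite ImN; under eq_fun do rewrite ImN; apply: is_deriveN.
Qed.

Lemma is_cderM f g s D E : is_cder f s D -> is_cder g s E ->
  is_cder (fun t => f t * g t) s (f s * E + D * g s).
Proof.
move=> [fr fi] [gr gi]; split.
  under eq_fun do rewrite ReM; apply: is_derive_eq.
  by rewrite /GRing.scale /= ReD !ReM; ring.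
under eq_fun do rewrite ImM; apply: is_derive_eq.
by rewrite /GRing.scale /= ImD !ImM; ring.
Qed.

Lemma is_cderZ c f s D : is_cder f s D -> is_cder (fun t => c * f t) s (c * D).
Proof.
move=> h; apply: is_cder_eq (is_cderM (is_cder_cst c s) h) _.
by rewrite mul0r addr0.
Qed.

Lemma is_cderX f s D n : is_cder f s D ->
  is_cder (fun t => f t ^+ n) s (n%:R * f s ^+ n.-1 * D).
Proof.
move=> h; elim: n => [|n IH].
  by rewrite mul0r mul0r; under eq_fun do rewrite expr0; apply: is_cder_cst.
under eq_fun do rewrite exprS; apply: is_cder_eq (is_cderM h IH) _.
case: n {IH} => [|n] /=; first by rewrite expr0; ring.
by rewrite -[n.+2]addn1 natrD exprS; ring.
Qed.

Lemma is_cder_horner (P : {poly C}) f s D : is_cder f s D ->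
  is_cder (fun t => P.[f t]) s ((deriv P).[f s] * D).
Proof.
move=> h; elim/poly_ind: P => [|P c IH].
  by rewrite deriv0 horner0 mul0r; under eq_fun do rewrite horner0; apply: is_cder_cst.
under eq_fun do rewrite hornerMXaddC.
apply: is_cder_eq (is_cderD (is_cderM IH h) (is_cder_cst c s)) _.
by rewrite derivD derivM derivC derivX !hornerE; ring.
Qed.

Lemma is_cder_exp f s D : is_cder f s D -> is_cder (fun t => expC (f t)) s (expC (f s) * D).
Proof.
move=> [fr fi].
have er : is_derive s 1 (fun t => expR (Re (f t))) (expR (Re (f s)) * Re D).
  exact: is_derive1_comp.
have ec : is_derive s 1 (fun t => cos (Im (f t))) (- sin (Im (f s)) * Im D).
  exact: is_derive1_comp.
have es : is_derive s 1 (fun t => sin (Im (f t))) (cos (Im (f s)) * Im D).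
  exact: is_derive1_comp.
split; rewrite /expC /=.
  by apply: is_derive_eq; rewrite /GRing.scale /= ReM /=; ring.
by apply: is_derive_eq; rewrite /GRing.scale /= ImM /=; ring.
Qed.

Lemma is_cderV f s D : f s != 0 -> is_cder f s D ->
  is_cder (fun t => (f t)^-1) s (- D / f s ^+ 2).
Proof.
move=> f0 [fr fi]; set n := fun t => Re (f t) ^+ 2 + Im (f t) ^+ 2.
have n0 : n s != 0.
  apply: contra f0; rewrite /n; case: (f s) => x y /=.
  by rewrite paddr_eq0 ?sqr_ge0 // !sqrf_eq0 => /andP[/eqP-> /eqP->].
have dn : is_derive s 1 n (2 * (Re (f s) * Re D + Im (f s) * Im D)).
  rewrite /n; under eq_fun do rewrite !expr2; apply: is_derive_eq.
  by rewrite /GRing.scale /=; ring.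
have dV : is_derive s 1 (fun t => (n t)^-1)
    (- (n s) ^- 2 * (2 * (Re (f s) * Re D + Im (f s) * Im D))).
  exact: is_deriveV.
have H z : z^-1 = (Re z / (Re z ^+ 2 + Im z ^+ 2)) +i* (- Im z / (Re z ^+ 2 + Im z ^+ 2)).
  by case: z => a b; rewrite mulNr.
have E : - D / f s ^+ 2 = (- Re D * (Re (f s) ^+ 2 - Im (f s) ^+ 2) / n s ^+ 2
     - Im D * (2 * Re (f s) * Im (f s)) / n s ^+ 2) +i*
     (- Im D * (Re (f s) ^+ 2 - Im (f s) ^+ 2) / n s ^+ 2
     + Re D * (2 * Re (f s) * Im (f s)) / n s ^+ 2).
  apply: (mulIf (expf_neq0 2 f0)); rewrite divfK ?expf_neq0 //.
  move: n0 {dV dn fr fi f0}; rewrite /n; case: (f s) => a b /=; case: D => x y /= n0.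
  apply/eqP; rewrite eq_complex /= !expr2 /=; apply/andP; split; apply/eqP; field; exact: n0.
rewrite E; split => /=.
  under eq_fun do rewrite H /=; apply: is_derive_eq; rewrite /GRing.scale /=.
  by rewrite -/(n s); move: n0; rewrite /n => n0; field.
under eq_fun do rewrite H /=; apply: is_derive_eq; rewrite /GRing.scale /=.
by rewrite -/(n s); move: n0; rewrite /n => n0; field.
Qed.

Lemma is_cder0_cst f : (forall s, is_cder f s 0) -> forall s t, f s = f t.
Proof.
move=> h s t.
have := is_derive_0_is_cst (f := fun t => Re (f t)) s t (fun x => (h x).1).
have := is_derive_0_is_cst (f := fun t => Im (f t)) s t (fun x => (h x).2).
by case: (f s) => ? ?; case: (f t) => ? ? /= -> ->.
Qed.

Lemma expC0 : expC (0 : C) = 1.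
Proof. by rewrite /expC /= expR0 cos0 sin0 mulr1 mulr0. Qed.

Lemma expCD (z w : C) : expC (z + w) = expC z * expC w.
Proof.
rewrite /expC ReD ImD expRD cosD sinD.
by apply/eqP; rewrite eq_complex /=; apply/andP; split; apply/eqP; ring.
Qed.

Lemma expC_neq0 (z : C) : expC z != 0.
Proof.
apply/eqP => e; have := expC0; rewrite -(subrr z) expCD e mul0r => /eqP.
by rewrite eq_sym oner_eq0.
Qed.

Lemma expCN (z : C) : expC (- z) = (expC z)^-1.
Proof. by apply: (mulIf (expC_neq0 z)); rewrite mulVf ?expC_neq0 // -expCD addNr expC0. Qed.

Lemma normc_expC (z : C) : normc (expC z) = expR (Re z).
Proof.
rewrite normc_sqrt /= !exprMn -mulrDr cos2Dsin2 mulr1 sqrtr_sqr.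
by rewrite ger0_norm // expR_ge0.
Qed.

Lemma normc_nat n : normc (n%:R : C) = n%:R.
Proof. by rewrite -(rmorph_nat (real_complex R)) normc_real normr_nat. Qed.

Lemma factC_neq0 m : (m`!)%:R != 0 :> C.
Proof. by rewrite pnatr_eq0 -lt0n fact_gt0. Qed.

Lemma ebnd_pow (z c : C) : ebnd (normc c) (normc z) (fun m => c * (z ^+ m / m`!%:R)).
Proof. by move=> m; rewrite !normcM normcX normcV normc_nat. Qed.

Section ExpSeries.
Variable z : C.

Let F t := csum (fun m => (t%:C * z) ^+ m / m`!%:R).

(** Termwise differentiation is taken from real power series, so it is run on a functional [f],
    meant to be the real or the imaginary part. The coefficients [c j] belong to [f (z ^+ j * F t)]:
    differentiating the series shifts [j] by one, which amounts to multiplication by [z]. *)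
Let term (f : C -> R) (c := fun j i => f (z ^+ (i + j)) / i`!%:R) :
  (forall (r : R) w, f (r%:C * w) = r * f w) -> (forall w, `|f w| <= normc w) ->
  (forall a, f (csum a) = limn (series (fun m => f (a m)))) ->
  forall t, is_derive t 1 (fun t => f (F t)) (f (z * F t)).
Proof.
move=> fZ fn fs t.
have cE j i s : f (z ^+ j * ((s%:C * z) ^+ i / i`!%:R)) = c j i * s ^+ i.
  rewrite /c -(rmorph_nat (real_complex R)) -fmorphV exprMn -rmorphXn.
  have -> : z ^+ j * ((s ^+ i)%:C * z ^+ i * (i`!%:R^-1)%:C) =
     (s ^+ i)%:C * ((i`!%:R^-1)%:C * z ^+ (i + j)) by rewrite exprD; ring.
  by rewrite !fZ; ring.
have limE j s : f (z ^+ j * F s) = limn (pseries (c j) s).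
  have := has_csumZ (z ^+ j) (ebnd_has_csum (ebnd_pow (s%:C * z) 1)).
  under eq_fun do rewrite mul1r.
  move=> /has_csumE; have -> : csum (fun m => 1 * ((s%:C * z) ^+ m / m`!%:R)) = F s.
    by rewrite /F; congr csum; apply/funext => m; rewrite mul1r.
  move=> <-; rewrite fs; congr (limn (series _)).
  by apply/funext => m /=; rewrite cE.
have cvg j s : cvgn (pseries (c j) s).
  rewrite /pseries; apply: normed_cvg.
  apply: (@series_le_cvg _ _ (normc (z ^+ j) *: exp_coeff (normc (s%:C * z)))) => [m|m|m|] //=.
  - by rewrite mulr_ge0 ?normc_ge0 // exp_coeff_ge0 // normc_ge0.
  - by rewrite -cE; apply: le_trans (fn _) (ebnd_pow _ _ _).
  - by apply: is_cvg_seriesZ; apply: is_cvg_series_exp_coeff.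
have dc j : pseries_diffs (c j) = c j.+1.
  apply/funext => i; rewrite /pseries_diffs /c factS natrM addSnnS.
  by rewrite invfM mulrCA mulVKf ?pnatr_eq0.
have -> : (fun t => f (F t)) = fun t => limn (pseries (c 0) t).
  by apply/funext => s; rewrite -limE expr0 mul1r.
have -> : f (z * F t) = limn (pseries (pseries_diffs (c 0)) t).
  by rewrite dc -limE expr1.
apply: (@pseries_snd_diffs _ _ (`|t| + 1)); rewrite ?dc //.
by rewrite [ltRHS]ger0_norm // ltrDl.
Qed.

(** The sum [F] satisfies F' = z F, so F(t) exp(- t z) has derivative zero and keeps its value 1
    from t = 0 to t = 1. *)
Lemma expC_has_csum : has_csum (fun m => z ^+ m / m`!%:R) (expC z).
Proof.
have dF t : is_cder F t (z * F t).
  split; apply: term => //.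
  - by move=> r w; rewrite ReM /= mul0r subr0.
  - exact: Re_normc.
  - by move=> r w; rewrite ImM /= mul0r addr0.
  - exact: Im_normc.
have F0 : F 0 = 1.
  have h : has_csum (fun m => (0%:C * z) ^+ m / m`!%:R) ((0%:C * z) ^+ 0 / 0`!%:R).
    by apply: has_csum1 => m m0; rewrite mul0r expr0n (negbTE m0) mul0r.
  by rewrite /F (has_csumE h) expr0 divr1.
have : F 1 * expC (- (1%:C * z)) = F 0 * expC (- (0%:C * z)).
  apply: (@is_cder0_cst (fun t => F t * expC (- (t%:C * z)))) => t.
  have dz : is_cder (fun t => - (t%:C * z)) t (- z).
    apply: is_cderN; apply: is_cder_eq (is_cderM (is_cder_id t) (is_cder_cst z t)) _.
    by rewrite mulr0 add0r mul1r.
  by apply: is_cder_eq (is_cderM (dF t) (is_cder_exp dz)) _; ring.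
rewrite F0 mul0r oppr0 expC0 mul1r mul1r expCN => /divr1_eq FE.
have := ebnd_has_csum (ebnd_pow z 1).
have -> : (fun m => 1 * (z ^+ m / m`!%:R)) = (fun m => (1%:C * z) ^+ m / m`!%:R).
  by apply/funext => m; rewrite !mul1r.
by rewrite -/(F 1) FE; under eq_fun do rewrite mul1r.
Qed.
End ExpSeries.

Lemma expCE (z : C) : expC z = csum (fun m => z ^+ m / m`!%:R).
Proof. by rewrite (has_csumE (expC_has_csum z)). Qed.

End ComplexDerivative.

(** * Divided differences of the exponential kernel and determinants freed of Vandermonde factors *)

Section ExponentialKernel.
Variable R : realType.
Local Notation C := R[i].
Implicit Types (X l : nat -> C) (a b p v : C).

Lemma ctends_expC (T : Type) (F : set_system T) (FF : Filter F) (f : T -> C) a :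
  ctends F f a -> ctends F (fun t => expC (f t)) (expC a).
Proof.
move=> [fr fi]; split; rewrite /expC /=; apply: cvgM.
- exact: (cvg_comp _ _ fr (@continuous_expR _ _)).
- exact: (cvg_comp _ _ fi (@continuous_cos _ _)).
- exact: (cvg_comp _ _ fr (@continuous_expR _ _)).
- exact: (cvg_comp _ _ fi (@continuous_sin _ _)).
Qed.

(* The divided difference, in [x] at [X 0, ..., X q] and in [y] at
   [l 0, ..., l q'], of [(a x + b) exp(x y)]. *)
Definition dexp a b X l q q' : C :=
  csum (fun m => ddm l m q' / m`!%:R * (a * ddm X m.+1 q + b * ddm X m q)).

Lemma node_bound X n : exists2 rho : R, 1 <= rho &
  forall s, (s < n)%N -> normc (X s) <= rho.
Proof.
elim: n => [|n [rho r1 h]]; first by exists 1.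
exists (rho + normc (X n)); first by rewrite ler_wpDr // normc_ge0.
move=> s; rewrite ltnS leq_eqVlt => /orP[/eqP->|sn].
  by rewrite lerDr (le_trans ler01).
by rewrite ler_wpDr ?normc_ge0 // h.
Qed.

(** [B] stands in for [normc b] so that the bound can be shared by all values of a varying [b]. *)
Lemma ebnd_dexp a b X l q q' (rho rho' B : R) :
  1 <= rho -> 1 <= rho' -> normc b <= B ->
  (forall s, (s <= q)%N -> normc (X s) <= rho) ->
  (forall s, (s <= q')%N -> normc (l s) <= rho') ->
  ebnd (normc a * (2 * rho) + B) (2 * rho' * (2 * rho))
    (fun m => ddm l m q' / m`!%:R * (a * ddm X m.+1 q + b * ddm X m q)).
Proof.
move=> r1 r1' bB hX hl m.
have r0 : 0 <= 2 * rho by rewrite mulr_ge0 // (le_trans ler01).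
rewrite !normcM normcV normc_nat /exp_coeff /= exprMn.
have -> : (normc a * (2 * rho) + B) * ((2 * rho') ^+ m * (2 * rho) ^+ m / m`!%:R) =
  (2 * rho') ^+ m / m`!%:R * ((normc a * (2 * rho) + B) * (2 * rho) ^+ m) by ring.
have f0 : 0 <= m`!%:R^-1 :> R by rewrite invr_ge0.
apply: ler_pM; rewrite ?mulr_ge0 ?normc_ge0 //.
  by rewrite ler_wpM2r // normc_ddm.
apply: le_trans (normcD _ _) _; rewrite !normcM mulrDl lerD //.
  rewrite -mulrA -[X in _ <= _ * X]exprS.
  exact: ler_wpM2l (normc_ge0 _) _ _ (normc_ddm m.+1 r1 hX).
by apply: ler_pM; rewrite ?normc_ge0 // normc_ddm.
Qed.

Lemma dexp_has_csum a b X l q q' :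
  has_csum (fun m => ddm l m q' / m`!%:R * (a * ddm X m.+1 q + b * ddm X m q))
    (dexp a b X l q q').
Proof.
have [rho r1 h] := node_bound X q.+1; have [rho' r1' h'] := node_bound l q'.+1.
exact: ebnd_has_csum (ebnd_dexp a r1 r1' (lexx _) h h').
Qed.

(** At nodes the finite Newton expansion of every monomial is exact in each variable, so the
    expansion passes through the series in [m]. The factor [a * X i + b] covers both exp(x y), with
    (a, b) = (0, 1), and the rows multiplied by u_i - v, with (a, b) = (1, - v). *)
Lemma dexpE a b X l n n' i j : (i < n)%N -> (j < n')%N ->
  (a * X i + b) * expC (X i * l j) =
  \sum_(q < n) newton X q (X i) *
    \sum_(q' < n') dexp a b X l q q' * newton l q' (l j).
Proof.
move=> lin ljn.
have H := has_csum_sum (fun q : 'I_n => newton X q (X i)) (fun q : 'I_n =>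
  has_csum_sum (fun q' : 'I_n' => newton l q' (l j)) (fun q' => dexp_has_csum a b X l q q')).
have E : (fun m => \sum_(q < n) newton X q (X i) * \sum_(q' < n') newton l q' (l j) *
   (ddm l m q' / m`!%:R * (a * ddm X m.+1 q + b * ddm X m q))) =
   fun m => (a * X i + b) * ((X i * l j) ^+ m / m`!%:R).
  apply/funext => m; rewrite exprMn.
  have -> : (a * X i + b) * (X i ^+ m * l j ^+ m / m`!%:R) =
     (a * X i ^+ m.+1 + b * X i ^+ m) * (l j ^+ m / m`!%:R) by rewrite exprS; ring.
  rewrite (newton_nodeE X m.+1 lin) (newton_nodeE X m lin) (newton_nodeE l m ljn).
  rewrite !mulr_sumr -big_split /= [in RHS]mulr_suml; apply: eq_bigr => q _.
  rewrite mulr_suml !mulr_sumr; apply: eq_bigr => q' _; ring.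
rewrite E in H.
have := has_csumZ (a * X i + b) (expC_has_csum (X i * l j)).
move=> /has_csumE <-; rewrite (has_csumE H).
by apply: eq_bigr => q _; congr (_ * _); apply: eq_bigr => q' _; rewrite mulrC.
Qed.

Lemma ctends_dexp (T : Type) (F : set_system T) (FF : Filter F) a (b : T -> C) b0
    (X l : T -> nat -> C) X0 l0 q q' :
  ctends F b b0 -> (forall s, (s <= q)%N -> ctends F (X^~ s) (X0 s)) ->
  (forall s, (s <= q')%N -> ctends F (l^~ s) (l0 s)) ->
  ctends F (fun t => dexp a (b t) (X t) (l t) q q') (dexp a b0 X0 l0 q q').
Proof.
move=> hb hX hl.
have [rho r1 [h0 h]] := ctends_bounded FF (n := q.+1) hX.
have [rho' r1' [h0' h']] := ctends_bounded FF (n := q'.+1) hl.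
have [B _ [hB0 hB]] := ctends_bounded FF (n := 1) (x := fun t _ => b t) (x0 := fun=> b0) (fun _ _ => hb).
apply: (@ctends_csum _ _ _ _ _ _ (normc a * (2 * rho) + B) (2 * rho' * (2 * rho))).
- by apply: ebnd_dexp => //; apply: (hB0 0%N).
- near=> t; apply: ebnd_dexp => //; near: t.
  + by apply: filterS hB => t /(_ 0%N); apply.
  + exact: h.
  + exact: h'.
- move=> m; apply: ctendsM.
    by apply: ctendsM; [exact: ctends_ddm|exact: ctends_cst].
  apply: ctendsD; apply: ctendsM; rewrite //; try exact: ctends_cst; exact: ctends_ddm.
Unshelve. all: by end_near. Qed.

(** The filler 0 makes 0^N extend to the zero sequence and (u, 0^N) to u, 0, 0, ... *)
Definition ext n (z : 'I_n -> C) (s : nat) : C := oapp z 0 (insub s).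

Lemma ext_ord n (z : 'I_n -> C) (i : 'I_n) : ext z i = z i.
Proof. by rewrite /ext valK. Qed.

Lemma ctends_ext (T : Type) (F : set_system T) (FF : Filter F) n (z : T -> 'I_n -> C) z0 s :
  (forall i, ctends F (z^~ i) (z0 i)) -> ctends F (fun t => ext (z t) s) (ext z0 s).
Proof. by move=> h; rewrite /ext; case: insubP => [i _ _|_] /=; [|exact: ctends_cst]. Qed.

Definition nmx n X : 'M[C]_n := \matrix_(i, q) newton X q (X i).

(** This is (-1)^(n(n-1)/2): [vdm] uses z_i - z_j for i < j, the Newton polynomials use the opposite
    differences. *)
Definition sgm n : C := \prod_(j < n) (-1) ^+ j.

Lemma sgmK n : sgm n * sgm n = 1.
Proof. by rewrite -big_split /= big1 // => j _; rewrite -expr2 sqrr_sign. Qed.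

Lemma sgm_neq0 n : sgm n != 0.
Proof.
by apply/eqP => s0; have /eqP := sgmK n; rewrite s0 mulr0 eq_sym oner_eq0.
Qed.

Lemma sgmV n : (sgm n)^-1 = sgm n.
Proof. by apply: (mulIf (sgm_neq0 n)); rewrite mulVf ?sgm_neq0 // sgmK. Qed.

Lemma vdm_nmx n (z : 'I_n -> C) : vdm z = sgm n * \det (nmx n (ext z)).
Proof.
rewrite /nmx newton_mx_det -prod_gt_newton; apply: eq_bigr => i _.
by apply: eq_bigr => j _; rewrite !ext_ord.
Qed.

Lemma vdm_neq0 n (z : 'I_n -> C) : injective z -> vdm z != 0.
Proof.
move=> zi; apply/prodf_neq0 => i _; apply/prodf_neq0 => j ij.
by rewrite subr_eq0; apply: contraTneq ij => /zi ->; rewrite ltnn.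
Qed.

Lemma nmx_neq0 n (z : 'I_n -> C) : injective z -> \det (nmx n (ext z)) != 0.
Proof. by move/vdm_neq0; rewrite vdm_nmx mulf_eq0 negb_or => /andP[]. Qed.

Definition Gmx n X l : 'M[C]_n := \matrix_(q, q') dexp 0 1 X l q q'.

(** The divided differences, in the u_i, of the columns left after row [i] is multiplied by u_i - v:
    the pole of the first column cancels and leaves exp(- p v) exp(p u_i), a kernel with the single
    second node [p]; the others are (u_i - v) exp(u_i l_j). *)
Definition Kmx n p v X l : 'M[C]_(1 + n) :=
  row_mx (\matrix_(i, _) (expC (- (p * v)) * dexp 0 1 X (fun=> p) i 0))
         (\matrix_(i, q) dexp 1 (- v) X l i q).

Lemma ctends_Kmx (T : Type) (F : set_system T) (FF : Filter F) n p (v : T -> C) v0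
    (X l : T -> nat -> C) X0 l0 :
  ctends F v v0 ->
  (forall s, ctends F (X^~ s) (X0 s)) -> (forall s, ctends F (l^~ s) (l0 s)) ->
  ctends F (fun t => \det (Kmx n p (v t) (X t) (l t))) (\det (Kmx n p v0 X0 l0)).
Proof.
move=> hv hX hl; apply: ctends_det => i j; rewrite /Kmx.
rewrite !mxE; under eq_fun do rewrite !mxE.
case: fintype.splitP => k _; rewrite !mxE; under eq_fun do rewrite !mxE.
  apply: ctendsM.
    by apply/ctends_expC/ctendsN/ctendsM => //; apply: ctends_cst.
  apply: ctends_dexp => //; first exact: ctends_cst.
  by move=> s _; apply: ctends_cst.
by apply: ctends_dexp => //; apply: ctendsN.
Qed.

Lemma det_row_scale n (c : 'I_n -> C) (A : 'M[C]_n) :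
  \det (\matrix_(i, j) (c i * A i j)) = (\prod_i c i) * \det A.
Proof.
have -> : \matrix_(i, j) (c i * A i j) = diag_mx (\row_i c i) *m A.
  by apply/matrixP => i j; rewrite mul_diag_mx !mxE.
by rewrite det_mulmx det_diag; congr (_ * _); apply: eq_bigr => i _; rewrite mxE.
Qed.

Lemma Bl_Gmx N (l : 'I_N -> R) (z : 'I_N -> C) (lc := ext (fun i => (l i)%:C)) :
  injective z -> Bl l z = sgm N * \det (nmx N lc) * \det (Gmx N (ext z) lc).
Proof.
move=> zi; rewrite /Bl vdm_nmx.
have -> : \matrix_(i, j) expC (z i * (l j)%:C) =
    nmx N (ext z) *m (Gmx N (ext z) lc *m (nmx N lc)^T).
  apply/matrixP => i j; rewrite mxE.
  have := dexpE 0 1 (ext z) lc (ltn_ord i) (ltn_ord j).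
  rewrite /lc mul0r add0r mul1r !ext_ord => ->; rewrite mxE.
  apply: eq_bigr => q _; rewrite !mxE ext_ord; congr (_ * _).
  by apply: eq_bigr => q' _; rewrite !mxE /lc ext_ord.
rewrite !det_mulmx det_tr; have := nmx_neq0 zi; set W := \det (nmx N (ext z)) => W0.
by rewrite invfM sgmV; field.
Qed.

Lemma Blp_Kmx N (l : 'I_N -> R) p (u : 'I_(1 + N) -> C) (v : 'I_1 -> C)
    (lc := ext (fun i => (l i)%:C)) : Blp_generic u v ->
  Blp l p u v = sgm N * \det (nmx N lc) * \det (Kmx N p (v ord0) (ext u) lc).
Proof.
move=> [ui _ uv]; rewrite /Blp; set M := \matrix_(i, j) _.
have -> : \prod_(i < 1) \prod_(j < 1 | (i < j)%N) (v j - v i) = 1.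
  by rewrite big_ord1 big_pred0 // => j; rewrite [j]ord1.
rewrite mulr1 -[LHS]mulrA; under eq_bigr do rewrite big_ord1.
set v0 := v ord0.
have -> : \prod_(i < 1 + N) (u i - v0) / vdm u * \det M =
     (vdm u)^-1 * \det (\matrix_(i, j) ((u i - v0) * M i j)).
  by rewrite det_row_scale; ring.
(* The identity corner keeps the first column, which does not involve the [l], out of the Newton
   expansion in [l]. *)
have -> : \matrix_(i, j) ((u i - v0) * M i j) = nmx (1 + N) (ext u) *m
   (Kmx N p v0 (ext u) lc *m block_mx 1%:M 0 0 (nmx N lc)^T).
  rewrite mul_row_block !mulmx0 addr0 add0r mulmx1 mul_mx_row.
  apply/matrixP => i j; rewrite !mxE.
  case: fintype.splitP => k _; rewrite !mxE.
    rewrite [k]ord1 -/v0 mulrCA divff ?subr_eq0 ?uv // mulr1.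
    rewrite mulrBr expCD [LHS]mulrC [p * u i]mulrC.
    have := dexpE 0 1 (ext u) (fun=> p) (ltn_ord i) (ltnSn 0).
    rewrite mul0r add0r mul1r !ext_ord => ->.
    rewrite mulr_sumr; apply: eq_bigr => q _; rewrite !mxE ext_ord big_ord1 /=.
    by rewrite [newton _ 0 _]big_ord0; ring.
  have := dexpE 1 (- v0) (ext u) lc (ltn_ord i) (ltn_ord k).
  rewrite /lc mul1r !ext_ord => ->; apply: eq_bigr => q _; rewrite !mxE ext_ord; congr (_ * _).
  by apply: eq_bigr => q' _; rewrite !mxE /lc ext_ord.
rewrite vdm_nmx !det_mulmx det_ublock det1 mul1r det_tr.
have := nmx_neq0 ui; set W := \det (nmx (1 + N) (ext u)) => W0.
(* This extra sign meets the prefactor (-1)^(N k) at k = 1, and the two multiply to 1. *)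
have -> : sgm (1 + N) = sgm N * (-1) ^+ N by rewrite /sgm big_ord_recr.
rewrite muln1 !invfM sgmV invr_sign.
have := sqrr_sign C N; set e := (-1) ^+ N => e2.
transitivity (e ^+ 2 * (sgm N * \det (nmx N lc) * \det (Kmx N p v0 (ext u) lc))).
  by field.
by rewrite e2 mul1r.
Qed.

End ExponentialKernel.

(** * Schur complements and bordered determinants *)

Section Schur.
Variable K : fieldType.

Lemma det_schur m n (A : 'M[K]_m) (B : 'M[K]_(m, n)) (D : 'M[K]_(n, m)) (E : 'M[K]_n) :
  \det E != 0 ->
  \det (block_mx A B D E) = \det E * \det (A - B *m invmx E *m D).
Proof.
move=> E0; have uE : E \in unitmx by rewrite unitmxE unitfE.
have := det_lblock (1%:M : 'M[K]_m) (- (invmx E *m D)) (1%:M : 'M[K]_n).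
rewrite !det1 mulr1 => h1.
have := congr1 determinant (mulmx_block A B D E 1%:M 0 (- (invmx E *m D)) 1%:M).
rewrite det_mulmx h1 mulr1 => ->.
rewrite !mulmx1 !mulmx0 !add0r !mulmxN !mulmxA mulmxV // mul1mx subrr.
by rewrite det_ublock mulrC.
Qed.

(** Bordering [E] by one row of [B] and one column of [D] gives a Schur complement of size one. This
    is what exhibits a k = 1 determinant in each entry of the complement for general k. *)
Lemma schur_entry m n (A : 'M[K]_m) (B : 'M[K]_(m, n)) (D : 'M[K]_(n, m)) (E : 'M[K]_n) i j :
  \det E != 0 ->
  \det (block_mx (A i j)%:M (row i B) (col j D) E : 'M[K]_(1 + n)) =
  \det E * (A - B *m invmx E *m D) i j.
Proof.
move=> E0; rewrite det_schur // det_mx11 -row_mul; move: (B *m invmx E) => Q.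
rewrite !mxE eqxx mulr1n; congr (_ * (_ - _)).
by apply: eq_bigr => q _; rewrite !mxE.
Qed.

Lemma det_scale n (c d : 'I_n -> K) (A : 'M[K]_n) :
  \det (\matrix_(i, j) (c i * A i j * d j)) = (\prod_i c i) * \det A * \prod_j d j.
Proof.
have -> : \matrix_(i, j) (c i * A i j * d j) =
    diag_mx (\row_i c i) *m A *m diag_mx (\row_i d i).
  by apply/matrixP => i j; rewrite mul_mx_diag mul_diag_mx !mxE.
by rewrite !det_mulmx !det_diag; congr (_ * _ * _); apply: eq_bigr => i _; rewrite mxE.
Qed.
End Schur.

(** * The ratio as a limit, and the reduction of general k to k = 1 *)

Section Ratio.
Variable R : realType.
Local Notation C := R[i].

(** Recasts the epsilon-delta clauses of [Bl_val], [Blp_val] and [ratio_is], each restricted to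
    admissible points [D], as limits along a filter, so that the calculus of [ctends] applies to
    them. *)
Definition rnbhs (T : Type) (D : set T) (close : R -> T -> Prop) : set_system T :=
  [set A | exists2 d : R, 0 < d & forall t, D t -> close d t -> A t].

Lemma rnbhs_filter (T : Type) (D : set T) (close : R -> T -> Prop) :
  (forall d e t, d <= e -> close d t -> close e t) -> Filter (rnbhs D close).
Proof.
move=> mono; split.
- by exists 1.
- move=> A B [d d0 dA] [e e0 eB]; exists (Num.min d e); first by rewrite lt_min d0 e0.
  move=> t Dt ct; split.
    by apply: dA => //; apply: mono ct; rewrite ge_min lexx.
  by apply: eB => //; apply: mono ct; rewrite ge_min lexx orbT.
- by move=> A B AB [d d0 dA]; exists d => // t Dt ct; apply/AB/dA.
Qed.

Definition Znear N (z0 : 'I_N -> C) := rnbhs (fun z : 'I_N -> C => injective z)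
  (fun d z => forall i, `|z i - z0 i| < d%:C).

Definition Unear N k (u0 : 'I_(k + N) -> C) (v0 : 'I_k -> C) :=
  rnbhs (fun x : ('I_(k + N) -> C) * ('I_k -> C) => Blp_generic x.1 x.2)
  (fun d x => (forall i, `|x.1 i - u0 i| < d%:C) /\ (forall j, `|x.2 j - v0 j| < d%:C)).

Definition Lnear N (l : 'I_N -> R) := rnbhs (fun l' => weyl l' /\ injective l')
  (fun d l' => forall i, `|l' i - l i| < d).

Global Instance Znear_filter N (z0 : 'I_N -> C) : Filter (Znear z0).
Proof.
by apply: rnbhs_filter => d e z de h i; apply: lt_le_trans (h i) _; rewrite lecR.
Qed.

Global Instance Unear_filter N k (u0 : 'I_(k + N) -> C) (v0 : 'I_k -> C) :
  Filter (Unear u0 v0).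
Proof.
apply: rnbhs_filter => d e x de [h1 h2].
by split=> i; [apply: lt_le_trans (h1 i) _|apply: lt_le_trans (h2 i) _]; rewrite lecR.
Qed.

Global Instance Lnear_filter N (l : 'I_N -> R) : Filter (Lnear l).
Proof. by apply: rnbhs_filter => d e z de h i; apply: lt_le_trans (h i) _. Qed.

Lemma Znear_coord N (z0 : 'I_N -> C) i : ctends (Znear z0) (fun z => z i) (z0 i).
Proof. by apply/ctendsP => e e0; exists e => // z _ /(_ i); rewrite normc_lt. Qed.

Lemma Unear_coord1 N k (u0 : 'I_(k + N) -> C) (v0 : 'I_k -> C) i :
  ctends (Unear u0 v0) (fun x => x.1 i) (u0 i).
Proof. by apply/ctendsP => e e0; exists e => // x _ [/(_ i)]; rewrite normc_lt. Qed.

Lemma Unear_coord2 N k (u0 : 'I_(k + N) -> C) (v0 : 'I_k -> C) j :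
  ctends (Unear u0 v0) (fun x => x.2 j) (v0 j).
Proof. by apply/ctendsP => e e0; exists e => // x _ [_ /(_ j)]; rewrite normc_lt. Qed.

Lemma Lnear_coord N (l : 'I_N -> R) i :
  ctends (Lnear l) (fun l' => (l' i)%:C) (l i)%:C.
Proof.
apply/ctendsP => e e0; exists e => // l' _ /(_ i).
by rewrite -rmorphB normc_real.
Qed.

Lemma Bl_valP N (l : 'I_N -> R) z0 L : ctends (Znear z0) (Bl l) L -> Bl_val l z0 L.
Proof.
move=> /ctendsP h e /h [d d0 dh]; exists d => // z zi zd.
by rewrite normc_lt; apply: dh.
Qed.

Lemma Blp_valP N k (l : 'I_N -> R) p (u0 : 'I_(k + N) -> C) v0 L :
  ctends (Unear u0 v0) (fun x => Blp l p x.1 x.2) L -> Blp_val l p u0 v0 L.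
Proof.
move=> /ctendsP h e /h [d d0 dh]; exists d => // u v g ud vd.
by rewrite normc_lt; apply: (dh (u, v)).
Qed.

(** The witness [Y] required at a nearby [l'] is [f l'], so continuity of [f] at [l] settles the
    clause for repeated coordinates. *)
Lemma ratio_isP N k (l : 'I_N -> R) p (u : 'I_(k + N) -> C) v (f : ('I_N -> R) -> C) :
  (forall l', injective l' -> ratio_at l' p u v (f l')) ->
  ctends (Lnear l) f (f l) -> ratio_is l p u v (f l).
Proof.
move=> h /ctendsP c; split=> [li|e /c [d d0 dh]]; first exact: h.
exists d => // l' wl' il' ll'; exists (f l'); split; first exact: h.
by rewrite normc_lt; apply: dh.
Qed.

Definition lnode N (l : 'I_N -> R) : nat -> C := ext (fun i => (l i)%:C).

(* The value at [z = 0^N] of [B_l], for [l] with distinct coordinates. *)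
Definition Bl0 N (l : 'I_N -> R) : C :=
  sgm R N * \det (nmx N (lnode l)) / \prod_(q < N) (q`!)%:R.

Lemma Bl0_neq0 N (l : 'I_N -> R) : injective l -> Bl0 l != 0.
Proof.
move=> li; rewrite /Bl0 !mulf_neq0 ?sgm_neq0 //.
  by apply: nmx_neq0 => i j /complexI /li.
by rewrite invr_eq0; apply/prodf_neq0 => q _; apply: factC_neq0.
Qed.

Lemma ddm0 m q : ddm (fun=> 0 : C) m q = (m == q)%:R.
Proof.
by elim: m q => [|m IH] [|q] //=; rewrite ?IH mul0r ?addr0 ?add0r.
Qed.

(** At zero nodes only the term [m = q] of each series survives, so entry (q, q') of [Gmx] is
    [ddm (lnode l) q q'] divided by q!. The matrix is triangular with diagonal 1/q!, the origin of
    the factorials in [Bl0]. *)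
Lemma Bl_tends N (l : 'I_N -> R) : ctends (Znear (fun=> 0)) (Bl l) (Bl0 l).
Proof.
apply: (@ctends_near_eq _ _ _ _
    (fun z => sgm R N * \det (nmx N (lnode l)) * \det (Gmx N (ext z) (lnode l)))).
  by exists 1 => // z zi _; rewrite Bl_Gmx.
have -> : Bl0 l = sgm R N * \det (nmx N (lnode l)) * \det (Gmx N (ext (fun _ : 'I_N => 0)) (lnode l)).
  congr (_ * _); rewrite det_trig.
    rewrite -prodfV; apply: eq_bigr => q _; rewrite mxE.
    have -> : (ext (fun _ : 'I_N => 0)) = fun=> 0 :> C.
      by apply/funext => s; rewrite /ext; case: insubP.
    rewrite /dexp (has_csumE (has_csum1 (k := q) _)).
      by rewrite mul0r add0r mul1r ddm0 eqxx mulr1 ddm_diag mul1r.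
    by move=> m mq; rewrite mul0r add0r mul1r ddm0 (negbTE mq) mulr0.
  apply/is_trig_mxP => q q' qq'; rewrite /Gmx mxE.
  have -> : (ext (fun _ : 'I_N => 0)) = fun=> 0 :> C.
    by apply/funext => s; rewrite /ext; case: insubP.
  rewrite /dexp (has_csumE (has_csum1 (k := q) _)); first by rewrite ddm_gt // !mul0r.
  by move=> m mq; rewrite mul0r add0r mul1r ddm0 (negbTE mq) mulr0.
apply: ctendsM; first exact: ctends_cst.
apply: ctends_det => i j; rewrite [X in ctends _ _ X]mxE.
rewrite [X in ctends _ X _](_ : _ = fun z => dexp 0 1 (ext z) (lnode l) i j); last first.
  by apply/funext => z; rewrite mxE.
apply: ctends_dexp => [|s _|s _]; try exact: ctends_cst.
by apply: (@ctends_ext _ _ _ _ N id) => {}i; apply: Znear_coord.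
Qed.

Definition unode (u : C) (s : nat) : C := if s is 0 then u else 0.

Lemma ext_with_zeros N (u : C) : ext (with_zeros (N := N) (fun _ : 'I_1 => u)) = unode u.
Proof.
apply/funext => s; rewrite /ext; case: insubP => [i _ <-|]; rewrite /= /with_zeros.
  by case: fintype.splitP => j ->; rewrite ?ord1.
by case: s.
Qed.

(* The value of [B_{l,p}(u, 0^N / v) / B_l(0^N)]. *)
Definition rat N p (u v : C) (l : 'I_N -> R) : C :=
  (\prod_(q < N) (q`!)%:R) * \det (Kmx N p v (unode u) (lnode l)).

Lemma Blp1_tends N (l : 'I_N -> R) p (u v : C) :
  ctends (Unear (with_zeros (N := N) (fun _ : 'I_1 => u)) (fun _ : 'I_1 => v))
    (fun x => Blp l p x.1 x.2) (Bl0 l * rat p u v l).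
Proof.
apply: (@ctends_near_eq _ _ _ _ (fun x => sgm R N * \det (nmx N (lnode l)) *
   \det (Kmx N p (x.2 ord0) (ext x.1) (lnode l)))).
  by exists 1 => // x xg _; rewrite Blp_Kmx.
have -> : Bl0 l * rat p u v l = sgm R N * \det (nmx N (lnode l)) *
    \det (Kmx N p v (unode u) (lnode l)).
  rewrite /rat /Bl0 mulrA divfK //.
  by apply/prodf_neq0 => q _; apply: factC_neq0.
apply: ctendsM; first exact: ctends_cst.
apply: ctends_Kmx => [|s|s]; last exact: ctends_cst.
- exact: (Unear_coord2 _ (fun _ : 'I_1 => v)).
- rewrite -(ext_with_zeros N u).
  by apply: (@ctends_ext _ _ _ _ _ fst) => i; apply: Unear_coord1.
Qed.

Lemma rat_cont N p u v (l : 'I_N -> R) : ctends (Lnear l) (rat p u v) (rat p u v l).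
Proof.
apply: ctendsM; first exact: ctends_cst.
apply: ctends_Kmx => [|s|s]; try exact: ctends_cst.
by apply: ctends_ext => i; apply: Lnear_coord.
Qed.

Lemma rat_ratio_is N p u v (l : 'I_N -> R) :
  ratio_is l p (with_zeros (N := N) (fun _ : 'I_1 => u)) (fun _ : 'I_1 => v) (rat p u v l).
Proof.
apply: ratio_isP; last exact: rat_cont.
move=> l' il'; exists (Bl0 l' * rat p u v l'), (Bl0 l'); split.
- exact/Blp_valP/Blp1_tends.
- exact/Bl_valP/Bl_tends.
- exact: Bl0_neq0.
- by rewrite [RHS]mulrAC divff ?mul1r // Bl0_neq0.
Qed.

Section GeneralK.
Variables (N k : nat) (p : C).

Definition ucons (a : C) (y : 'I_N -> C) (s : 'I_(1 + N)) : C :=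
  match fintype.split s with inl _ => a | inr b => y b end.

Lemma ucons_l a y i : ucons a y (lshift N i) = a.
Proof. by rewrite /ucons (unsplitK (inl i)). Qed.

Lemma ucons_r a y b : ucons a y (rshift 1 b) = y b.
Proof. by rewrite /ucons (unsplitK (inr b)). Qed.

Definition kprod (x v : 'I_k -> C) : C :=
  (\prod_(i < k) \prod_(j < k) (x i - v j)) /
  (\prod_(i < k) \prod_(j < k | (i < j)%N) ((x i - x j) * (v j - v i))).

Lemma vdm_split m (U : 'I_(m + N) -> C) :
  vdm U = vdm (U \o lshift N) * vdm (U \o @rshift m N) *
    \prod_(i < m) \prod_(b < N) (U (lshift N i) - U (rshift m b)).
Proof.
rewrite /vdm big_split_ord /=.
have -> : \prod_(i < N) \prod_(j < m + N | (rshift m i < j)%N) (U (rshift m i) - U j) =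
   \prod_(i < N) \prod_(j < N | (i < j)%N) (U (rshift m i) - U (rshift m j)).
  apply: eq_bigr => i _; rewrite big_mkcond big_split_ord /= big1; last first.
    by move=> j _; rewrite ltnNge (leq_trans (ltnW (ltn_ord j))) // leq_addr.
  rewrite mul1r [RHS]big_mkcond; apply: eq_bigr => j _.
  by rewrite ltn_add2l.
rewrite mulrAC -big_split /=; congr (_ * _); apply: eq_bigr => i _.
rewrite big_mkcond big_split_ord /=; congr (_ * _); first by rewrite [RHS]big_mkcond.
by apply: eq_bigr => b _; rewrite (leq_trans (ltn_ord i)) // leq_addr.
Qed.

Lemma vdm1 (z : 'I_1 -> C) : vdm z = 1.
Proof. by rewrite /vdm big_ord1 big_pred0 // => j; rewrite [j]ord1. Qed.

(** The determinantal formula of the theorem is already an exact identity at generic arguments, with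
    [y] in the place of 0^N; limits are taken only afterwards. *)
Lemma Blp_schur (l : 'I_N -> R) (U : 'I_(k + N) -> C) (V : 'I_k -> C)
    (x := U \o lshift N) (y := U \o @rshift k N) :
  Blp_generic U V -> Bl l y != 0 ->
  Blp l p U V = Bl l y * (kprod x V *
    \det (\matrix_(i, j) ((x i - V j)^-1 * (Blp l p (ucons (x i) y) (fun _ : 'I_1 => V j) / Bl l y)))).
Proof.
move=> [Ui Vi UV] B0.
have yi : injective y by move=> a b /Ui /rshift_inj.
have xi : injective x by move=> a b /Ui /lshift_inj.
have vy := vdm_neq0 yi; have vx := vdm_neq0 xi.
have xy i b : x i - y b != 0.
  by rewrite subr_eq0; apply: contraTneq isT => /Ui /eqP; rewrite eq_lrshift.
have xV i j : x i - V j != 0 by rewrite subr_eq0 UV.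
pose E := \matrix_(a < N, b < N) expC (y a * (l b)%:C).
pose A := \matrix_(i < k, j < k) (expC (p * (x i - V j)) / (x i - V j)).
pose B := \matrix_(i < k, b < N) expC (x i * (l b)%:C).
pose D := \matrix_(a < N, j < k) (expC (p * (y a - V j)) / (y a - V j)).
have BE : Bl l y = \det E / vdm y by [].
have E0 : \det E != 0 by move: B0; rewrite BE mulf_eq0 negb_or => /andP[].
pose S := A - B *m invmx E *m D.
(* By [schur_entry], the k = 1 function at (x_i, y / V_j) is the entry S_ij up to explicit
   products. *)
have Blp1 i j : Blp l p (ucons (x i) y) (fun _ : 'I_1 => V j) =
   (-1) ^+ N * ((x i - V j) * \prod_b (y b - V j) / (vdm y * \prod_b (x i - y b))) *
   (\det E * S i j).
  rewrite -[\det E * S i j](schur_entry A B D i j E0) /Blp muln1; congr (_ * (_ / _) * _).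
  - rewrite (@big_split_ord _ _ _ 1) /= !big_ord1 ucons_l.
    by congr (_ * _); apply: eq_bigr => b _; rewrite big_ord1 ucons_r.
  - have -> : \prod_(i0 < 1) \prod_(j0 < 1 | (i0 < j0)%N) (V j - V j) = 1.
      by rewrite big_ord1 big_pred0 // => j'; rewrite [j']ord1.
    rewrite mulr1 (vdm_split (m := 1)) vdm1 big_ord1 mul1r; congr (_ * _).
      by apply: eq_bigr => b _; apply: eq_bigr => b' _; rewrite /= !ucons_r.
    by apply: eq_bigr => b _; rewrite ucons_l ucons_r.
  - congr (\det _); apply/matrixP => a b; rewrite !mxE /ucons.
    by case: (fintype.splitP a) => a' _; rewrite !mxE;
      case: (fintype.splitP b) => b' _; rewrite !mxE ?ord1 ?eqxx ?mulr1n.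
(* After division by [Bl l y] the factors [\det E], [vdm y] and x_i - V_j cancel; what is left
   beside S_ij depends on the row alone or on the column alone. *)
have -> : \matrix_(i, j) ((x i - V j)^-1 * (Blp l p (ucons (x i) y) (fun=> V j) / Bl l y)) =
   \matrix_(i, j) (((-1) ^+ N / \prod_b (x i - y b)) * S i j * \prod_b (y b - V j)).
  apply/matrixP => i j; rewrite [LHS]mxE [RHS]mxE Blp1 BE.
  have P0 : \prod_b (x i - y b) != 0 by apply/prodf_neq0 => b _.
  move: P0 (xV i j) vy E0; move: (\prod_b (x i - y b)) (x i - V j) (vdm y) (\det E).
  move: ((-1) ^+ N) (\prod_b (y b - V j)) (S i j) => e P S' P1 d w dE P10 d0 w0 dE0.
  by field; rewrite d0 w0 dE0 P10.
rewrite det_scale big_split /= prodr_const card_ord -exprM prodfV.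
have -> : Blp l p U V = (-1) ^+ (N * k) *
  (((\prod_i \prod_j (x i - V j)) * \prod_b \prod_j (y b - V j)) /
   (vdm x * vdm y * (\prod_i \prod_b (x i - y b)) *
    \prod_(i < k) \prod_(j < k | (i < j)%N) (V j - V i))) * (\det E * \det S).
  rewrite /Blp -det_schur //; congr (_ * (_ / (_ * _)) * _).
  - by rewrite big_split_ord.
  - exact: vdm_split.
  - congr (\det _); apply/matrixP => a b; rewrite !mxE.
    case: (fintype.splitP a) => a' ea; rewrite !mxE;
      [have -> : a = lshift N a' by apply: val_inj
      |have -> : a = rshift k a' by apply: val_inj];
      by case: (fintype.splitP b) => b' _; rewrite !mxE.
have kE : kprod x V = (\prod_i \prod_j (x i - V j)) / (vdm x *
    \prod_(i < k) \prod_(j < k | (i < j)%N) (V j - V i)).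
  rewrite /kprod /vdm -big_split /=; congr (_ / _); apply: eq_bigr => i _.
  by rewrite big_split.
rewrite kE BE [X in _ = _ * (_ * (_ * X))]exchange_big /=.
have Vv : \prod_(i < k) \prod_(j < k | (i < j)%N) (V j - V i) != 0.
  apply/prodf_neq0 => i _; apply/prodf_neq0 => j ij.
  by rewrite subr_eq0; apply: contraTneq ij => /Vi ->; rewrite ltnn.
have P0 : \prod_i \prod_b (x i - y b) != 0.
  by apply/prodf_neq0 => i _; apply/prodf_neq0 => b _.
move: vx vy Vv P0 E0; move: (vdm x) (vdm y) (\det E) (\det S) ((-1) ^+ (N * k)).
move: (\prod_i \prod_b (x i - y b)) (\prod_(i < k) \prod_(j < k | (i < j)%N) (V j - V i)).
move=> P1 P2 wx wy dE dS e wx0 wy0 P20 P10 dE0.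
by field; rewrite wx0 wy0 P20 P10.
Qed.

Lemma Blpk_tends (l : 'I_N -> R) (u v : 'I_k -> C) :
  injective u -> injective v -> (forall i j, u i != v j) -> injective l ->
  ctends (Unear (with_zeros (N := N) u) v) (fun x => Blp l p x.1 x.2)
    (Bl0 l * (kprod u v * \det (\matrix_(i, j) ((u i - v j)^-1 * rat p (u i) (v j) l)))).
Proof.
move=> ui vi uv li.
set F := Unear _ _.
have wl i : with_zeros (N := N) u (lshift N i) = u i by rewrite /with_zeros (unsplitK (inl i)).
have wr b : with_zeros (N := N) u (rshift k b) = 0 by rewrite /with_zeros (unsplitK (inr b)).
have hx i : ctends F (fun x => x.1 (lshift N i)) (u i) by rewrite -wl; apply: Unear_coord1.
have hv j : ctends F (fun x => x.2 j) (v j) by apply: Unear_coord2.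
have hB : ctends F (fun x => Bl l (x.1 \o @rshift k N)) (Bl0 l).
  apply: (@ctends_comp _ _ _ F (Znear (fun=> 0)) _ _ (fun x => x.1 \o @rshift k N) (Bl l)).
    move=> A [d d0 dA]; exists d => // x [xi _ _] [xd _]; apply: dA.
      by move=> a b /xi /rshift_inj.
    by move=> b /=; rewrite -(wr b).
  exact: Bl_tends.
(* Keeping one u_i, one v_j and the block close to 0^N sends generic points to generic points and
   does not increase distances, so the k = 1 limit pulls back along this map. *)
have h1 i j : ctends F (fun x => Blp l p (ucons (x.1 (lshift N i)) (x.1 \o @rshift k N))
     (fun _ : 'I_1 => x.2 j)) (Bl0 l * rat p (u i) (v j) l).
  apply: (@ctends_comp _ _ _ F _ _ _ (fun x => (ucons (x.1 (lshift N i)) (x.1 \o @rshift k N),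
     (fun _ : 'I_1 => x.2 j))) (fun x => Blp l p x.1 x.2) _ _ (Blp1_tends l p (u i) (v j))).
  move=> A [d d0 dA]; exists d => // x [xi yi xy] [xd yd]; apply: dA.
    split=> /=.
    - move=> a b; rewrite /ucons; case: fintype.splitP => a' ea; case: fintype.splitP => b' eb.
      + by move=> _; apply: val_inj; rewrite /= ea eb !ord1.
      + by move=> /xi /eqP; rewrite eq_lrshift.
      + by move=> /xi /eqP; rewrite eq_rlshift.
      + by move=> /xi /rshift_inj ab; apply: val_inj; rewrite /= ea eb ab.
    - by move=> a b _; rewrite !ord1.
    - by move=> a _; rewrite /ucons; case: fintype.splitP => a' _; apply: xy.
  split=> /= [a|_]; last exact: yd.
  rewrite /ucons /with_zeros; case: fintype.splitP => a' _; first by rewrite -(wl i).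
  by rewrite /= -(wr a').
apply: (@ctends_near_eq R _ F (Unear_filter _ _)
    (fun x : ('I_(k + N) -> C) * ('I_k -> C) => Bl l (x.1 \o @rshift k N) *
   (kprod (x.1 \o lshift N) x.2 * \det (\matrix_(i, j) (((x.1 \o lshift N) i - x.2 j)^-1 *
   (Blp l p (ucons ((x.1 \o lshift N) i) (x.1 \o @rshift k N)) (fun _ : 'I_1 => x.2 j) /
    Bl l (x.1 \o @rshift k N))))))).
  (* The Schur identity divides by [Bl l y], which is nonzero for [y] near 0^N because its limit
     [Bl0 l] is nonzero for distinct coordinates. *)
  have [d d0 dh] := ctends_neq0 _ (Bl0_neq0 li) hB.
  by exists d => // x xg xd; rewrite -Blp_schur //; apply: dh.
apply: ctendsM => //; apply: ctendsM.
  apply: ctendsM.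
    by apply: ctends_prod => i _; apply: ctends_prod => j _; apply: ctendsB; [exact: hx|].
  apply: ctendsV.
    apply/prodf_neq0 => i _; apply/prodf_neq0 => j ij.
    by apply: mulf_neq0; rewrite subr_eq0;
      [apply: contraTneq ij => /ui ->|apply: contraTneq ij => /vi ->]; rewrite ltnn.
  apply: ctends_prod => i _; apply: ctends_prod => j _.
  by apply: ctendsM; apply: ctendsB; [exact: hx|exact: hx| |].
apply: ctends_det => i j; rewrite [X in ctends _ _ X]mxE; under eq_fun do rewrite mxE.
apply: ctendsM.
  by apply: ctendsV; [rewrite subr_eq0|apply: ctendsB; [exact: hx|]].
have -> : rat p (u i) (v j) l = Bl0 l * rat p (u i) (v j) l / Bl0 l.
  by rewrite [RHS]mulrAC divff ?mul1r // Bl0_neq0.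
by apply: ctendsM; [exact: h1|apply: ctendsV => //; apply: Bl0_neq0].
Qed.

Lemma ratk_ratio_is (l : 'I_N -> R) (u v : 'I_k -> C) :
  injective u -> injective v -> (forall i j, u i != v j) ->
  ratio_is l p (with_zeros (N := N) u) v
    (kprod u v * \det (\matrix_(i, j) ((u i - v j)^-1 * rat p (u i) (v j) l))).
Proof.
move=> ui vi uv.
apply: (@ratio_isP _ _ _ _ _ _ (fun l =>
  kprod u v * \det (\matrix_(i, j) ((u i - v j)^-1 * rat p (u i) (v j) l)))).
  move=> l' il'.
  exists (Bl0 l' * (kprod u v * \det (\matrix_(i, j) ((u i - v j)^-1 * rat p (u i) (v j) l')))).
  exists (Bl0 l'); split.
  - exact/Blp_valP/Blpk_tends.
  - exact/Bl_valP/Bl_tends.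
  - exact: Bl0_neq0.
  - by rewrite [RHS]mulrAC divff ?mul1r // Bl0_neq0.
apply: ctendsM; first exact: ctends_cst.
apply: ctends_det => i j; rewrite [X in ctends _ _ X]mxE; under eq_fun do rewrite mxE.
by apply: ctendsM; [exact: ctends_cst|exact: rat_cont].
Qed.

End GeneralK.
End Ratio.

(** * Closed form of the k = 1 ratio *)

Section RatioValue.
Variable R : realType.
Local Notation C := R[i].
Variables (N : nat) (l : 'I_N -> R).
Implicit Types (p u v : C).
Local Notation lc := (lnode l).

(* The divided difference of [y |-> exp(u y)] at [l 0, ..., l q]. *)
Definition ecoef u q : C := csum (fun m => ddm lc m q * (u ^+ m / m`!%:R)).

(* The Newton interpolant of [y |-> exp(u y)] at the nodes [l]. *)
Definition einterp u : {poly C} := \sum_(q < N) ecoef u q *: newtonP lc q.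

Lemma ddm_cst0 (x : nat -> C) m : ddm x m 0 = x 0%N ^+ m.
Proof. by elim: m => [|m IH] //=; rewrite add0r IH exprS. Qed.

(** At the nodes u, 0, 0, ... the divided difference of X^m of order i is u^(m-i) if i <= m and 0
    otherwise, so consecutive orders differ by a factor u except at i = m. *)
Lemma ddm_unode u m i :
  ddm (unode u) m i - u * ddm (unode u) m i.+1 = (m == i)%:R.
Proof.
elim: m i => [|m IH] [|i] //=; rewrite ?mulr0 ?subr0 //.
- by rewrite mul0r add0r addr0 subrr.
- by rewrite !mul0r !addr0 IH.
Qed.

Lemma ecoef_has_csum u q : has_csum (fun m => ddm lc m q * (u ^+ m / m`!%:R)) (ecoef u q).
Proof.
have := dexp_has_csum 0 1 (fun=> u) lc 0 q.
have -> : (fun m => ddm lc m q / m`!%:R * (0 * ddm (fun=> u) m.+1 0 + 1 * ddm (fun=> u) m 0)) =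
   fun m => ddm lc m q * (u ^+ m / m`!%:R).
  by apply/funext => m; rewrite mul0r add0r mul1r ddm_cst0 mulrAC mulrA.
by move=> h; rewrite /ecoef (has_csumE h).
Qed.

(** By [ddm_unode] the combination leaves two terms of the series, those with m = i and m + 1 = i;
    for i = 0 the factor [i%:R] removes the second one and makes the value of [i.-1] immaterial. *)
Lemma dexp_diff a b u (x : nat -> C) i q :
  dexp a b (unode u) x i q - u * dexp a b (unode u) x i.+1 q =
  (a * (i%:R * ddm x i.-1 q) + b * ddm x i q) / i`!%:R.
Proof.
have h := has_csumD (dexp_has_csum a b (unode u) x i q)
  (has_csumZ (- u) (dexp_has_csum a b (unode u) x i.+1 q)).
rewrite -mulNr -(has_csumE h).
have h1 : has_csum (fun m => ddm x m q / m`!%:R * (m == i)%:R) (ddm x i q / i`!%:R).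
  rewrite -[X in has_csum _ X]mulr1 -[X in has_csum _ (_ * X)]/(true%:R) -(eqxx i).
  by apply: (@has_csum1 _ (fun m => ddm x m q / m`!%:R * (m == i)%:R)) => m /negbTE->; rewrite mulr0.
have h2 : has_csum (fun m => ddm x m q / m`!%:R * (m.+1 == i)%:R)
    (i%:R * ddm x i.-1 q / i`!%:R).
  case: i {h h1} => [|i].
    rewrite !mul0r; under eq_fun do rewrite mulr0.
    exact: (@has_csum1 _ (fun=> 0) 0).
  have -> : i.+1%:R * ddm x i.+1.-1 q / i.+1`!%:R = ddm x i q / i`!%:R * (i.+1 == i.+1)%:R.
    rewrite eqxx mulr1 factS natrM invfM [_ * ddm x _ _]mulrC -mulrA mulVKf ?pnatr_eq0 //.
  by apply: (@has_csum1 _ (fun m => ddm x m q / m`!%:R * (m.+1 == i.+1)%:R)) => m;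
     rewrite eqSS => /negbTE->; rewrite mulr0.
have -> : (a * (i%:R * ddm x i.-1 q) + b * ddm x i q) / i`!%:R =
   a * (i%:R * ddm x i.-1 q / i`!%:R) + b * (ddm x i q / i`!%:R) by ring.
rewrite -(has_csumE (has_csumD (has_csumZ a h2) (has_csumZ b h1))); congr csum.
apply/funext => m.
by rewrite -[(_ == _)%:R](ddm_unode u m.+1) -[(m == i)%:R](ddm_unode u m i) /=; ring.
Qed.

Lemma sum_delta n (a : 'I_n) (f : 'I_n -> C) : \sum_j (j == a)%:R * f j = f a.
Proof.
rewrite (bigD1 a) //= eqxx mul1r big1 ?addr0 // => j /negbTE->; exact: mul0r.
Qed.

Lemma dexp00 u (x : C) : dexp 0 1 (unode u) (fun=> x) 0 0 = expC (u * x).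
Proof.
have := dexpE 0 1 (unode u) (fun=> x) (ltnSn 0) (ltnSn 0).
by rewrite mul0r add0r mul1r !big_ord1 /newton !big_ord0 mul1r mulr1 /= => ->.
Qed.

Lemma dexp0q u v q : dexp 1 (- v) (unode u) lc 0 q = (u - v) * ecoef u q.
Proof.
rewrite -(has_csumE (has_csumZ (u - v) (ecoef_has_csum u q))); congr csum.
by apply/funext => m; rewrite !ddm_cst0 -[unode u 0]/u exprS; ring.
Qed.

Lemma det_Kmx p u v : v != 0 ->
  (- u) ^+ N * \det (Kmx N p v (unode u) lc) =
  (- v) ^+ N / (\prod_(q < N) (q`!)%:R) *
  (expC (p * (u - v)) + (u - v) * (expC (- (p * v)) * (antider v^-1 N (einterp u)).[p])).
Proof.
move=> v0.
(* Row operations: row 0 is kept, and row i + 1 becomes row i minus u times row i + 1. This [L] is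
   lower triangular with diagonal 1, - u, ..., - u. *)
pose L : 'M[C]_(1 + N) := \matrix_(i, j)
  match fintype.split i with inl _ => (j == ord0)%:R
  | inr i' => (j == widen_ord (leqnSn N) i')%:R - u * (j == rshift 1 i')%:R end.
have detL : \det L = (- u) ^+ N.
  rewrite det_trig.
    rewrite (@big_split_ord _ _ _ 1) /= big_ord1 mxE (unsplitK (inl _)) mul1r.
    rewrite -[X in _ ^+ X]card_ord -prodr_const; apply: eq_bigr => i _.
    rewrite mxE (unsplitK (inr _)) eqxx mulr1 -val_eqE /=.
    by rewrite add1n gtn_eqF // sub0r.
  apply/is_trig_mxP => i j ij; rewrite mxE.
  case: fintype.splitP => i' ei.
    by move: ij; rewrite -val_eqE /= ei ord1 /=; case: (j : nat).
  move: ij; rewrite -!val_eqE /= ei add1n => ij.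
  by rewrite !gtn_eqF ?mulr0 ?subr0 //; apply: ltnW.
(* Row i holds the Newton coefficients of (d/dX - v) applied to X^i / i!; the operator does not
   raise degrees, so the matrix is triangular with diagonal - v / i!. *)
pose Delta : 'M[C]_N := \matrix_(i, q)
  ((i%:R * ddm lc i.-1 q - v * ddm lc i q) / i`!%:R).
pose gam : 'cV[C]_N := \col_i (expC (- (p * v)) * (p ^+ i / i`!%:R)).
pose bet : 'rV[C]_N := \row_q ((u - v) * ecoef u q).
(* The solution of Delta Y = gam, read off from [antider_newtonP] at the point [p]; the Schur
   complement then needs [bet *m Y] and no explicit inverse. *)
pose Y : 'cV[C]_N := \col_q (- expC (- (p * v)) * (antider v^-1 N (newtonP lc q)).[p]).
have LK : L *m Kmx N p v (unode u) lc = block_mx (expC (p * (u - v)))%:M bet gam Delta.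
  have Lrow i j : (L *m Kmx N p v (unode u) lc) i j =
    match fintype.split i with inl _ => Kmx N p v (unode u) lc ord0 j
    | inr i' => Kmx N p v (unode u) lc (widen_ord (leqnSn N) i') j -
                u * Kmx N p v (unode u) lc (rshift 1 i') j end.
    rewrite mxE; case si: (fintype.split i) => [i'|i'].
      by under eq_bigr do rewrite mxE si; rewrite sum_delta.
    under eq_bigr do rewrite mxE si mulrBl -mulrA.
    by rewrite sumrB -mulr_sumr !sum_delta.
  apply/matrixP => i j; rewrite Lrow [RHS]mxE.
  case: (fintype.splitP i) => i' _; rewrite !mxE; case: (fintype.splitP j) => j' _; rewrite !mxE.
  - by rewrite !ord1 eqxx mulr1n dexp00 -expCD; congr expC; ring.
  - by rewrite dexp0q.
  - rewrite mulrCA -mulrBr; congr (_ * _); rewrite /= dexp_diff !ddm_cst0.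
    by rewrite mul0r add0r mul1r.
  - by rewrite /= dexp_diff mul1r mulNr.
have detD : \det Delta = (- v) ^+ N / (\prod_(q < N) (q`!)%:R).
  rewrite det_trig.
    rewrite -[X in _ ^+ X]card_ord -prodr_const -prodfV -big_split /=.
    apply: eq_bigr => i _; rewrite mxE ddm_diag mulr1; congr (_ / _).
    case: (i : nat) => [|n] /=; first by rewrite mul0r sub0r.
    by rewrite ddm_gt // mulr0 sub0r.
  apply/is_trig_mxP => i j ij; rewrite mxE !ddm_gt ?mulr0 ?subr0 ?mul0r //.
  exact: leq_ltn_trans (leq_pred i) ij.
have fN0 : \prod_(q < N) (q`!)%:R != 0 :> C by apply/prodf_neq0 => q _; apply: factC_neq0.
have D0 : \det Delta != 0.
  by rewrite detD mulf_neq0 ?invr_eq0 // expf_neq0 // oppr_eq0.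
have DY : Delta *m Y = gam.
  apply/matrixP => i j; rewrite !mxE.
  rewrite -(antider_newtonP lc p (mulfV v0) (ltn_ord i)) mulr_suml mulr_sumr.
  by apply: eq_bigr => q _; rewrite !mxE; ring.
rewrite -detL -det_mulmx LK det_schur // detD -DY mulmxA mulmxKV; last first.
  by rewrite unitmxE unitfE.
congr (_ * _); rewrite det_mx11 !mxE eqxx mulr1n; congr (_ + _).
rewrite /einterp antider_sum horner_sum !mulr_sumr -sumrN.
by apply: eq_bigr => q _; rewrite antiderZ hornerZ !mxE; ring.
Qed.

Lemma ratE p u v : u != 0 -> v != 0 ->
  rat p u v l = (v / u) ^+ N *
  (expC (p * (u - v)) + (u - v) * (expC (- (p * v)) * (antider v^-1 N (einterp u)).[p])).
Proof.
move=> u0 v0; have uN : (- u) ^+ N != 0 by rewrite expf_neq0 // oppr_eq0.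
have fN0 : \prod_(q < N) (q`!)%:R != 0 :> C by apply/prodf_neq0 => q _; apply: factC_neq0.
apply: (mulfI uN); rewrite /rat mulrCA det_Kmx // !mulrA; congr (_ * _).
rewrite [X in X / _]mulrC mulfK // -exprMn; congr (_ ^+ _).
by field.
Qed.

End RatioValue.

(** * Integration of complex-valued functions on the unit interval *)

Section UnitInterval.
Variable R : realType.
Local Notation C := R[i].
Local Notation Re := (@complex.Re R).
Local Notation Im := (@complex.Im R).
Local Notation mu := (@lebesgue_measure R).
Local Notation I01 := (`[0, 1]%classic : set R).
Implicit Types f h : R -> C.

(** Continuity relative to [0, 1], since [C1_loop] grants no more than this for the derivative of
    the loop. *)
Definition ccont f := forall s, I01 s -> ctends (within I01 (nbhs s)) f (f s).

Lemma ccont_within f : ccont f ->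
  {within I01, continuous (fun s => Re (f s))} /\ {within I01, continuous (fun s => Im (f s))}.
Proof. by move=> cf; split; apply/subspace_continuousP => s /cf []. Qed.

Lemma ccont_cst c : ccont (fun=> c). Proof. by move=> s _; apply: ctends_cst. Qed.
Lemma ccontD f h : ccont f -> ccont h -> ccont (fun s => f s + h s).
Proof. by move=> cf ch s As; apply: ctendsD; [exact: cf|exact: ch]. Qed.
Lemma ccontN f : ccont f -> ccont (fun s => - f s).
Proof. by move=> cf s As; apply: ctendsN; exact: cf. Qed.
Lemma ccontM f h : ccont f -> ccont h -> ccont (fun s => f s * h s).
Proof. by move=> cf ch s As; apply: ctendsM; [exact: cf|exact: ch]. Qed.
Lemma ccontV f : (forall s, I01 s -> f s != 0) -> ccont f -> ccont (fun s => (f s)^-1).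
Proof. by move=> f0 cf s As; apply: ctendsV; [exact: f0|exact: cf]. Qed.
Lemma ccont_exp f : ccont f -> ccont (fun s => expC (f s)).
Proof. by move=> cf s As; apply: ctends_expC; exact: cf. Qed.
Lemma ccont_sum (J : Type) (r : seq J) (f : J -> R -> C) :
  (forall i, ccont (f i)) -> ccont (fun s => \sum_(i <- r) f i s).
Proof. by move=> cf s As; apply: ctends_sum => i _; exact: cf. Qed.
Lemma ccontX f n : ccont f -> ccont (fun s => f s ^+ n).
Proof.
move=> cf; elim: n => [|n IH]; first by under eq_fun do rewrite expr0; apply: ccont_cst.
by under eq_fun do rewrite exprS; apply: ccontM.
Qed.

Lemma is_derive_within (F : R -> R) (A : set R) (s D : R) :
  is_derive s 1 F D -> F @ within A (nbhs s) --> F s.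
Proof.
move=> dF; apply: cvg_within_filter.
by apply/differentiable_continuous/derivable1_diffP.
Qed.

Lemma is_cder_ccont f D : (forall s, I01 s -> is_cder f s (D s)) -> ccont f.
Proof. by move=> df s /df [fr fi]; split; apply: is_derive_within. Qed.

Lemma cint_eq (A : set R) f h : (forall s, A s -> f s = h s) -> cint A f = cint A h.
Proof.
by move=> fh; rewrite /cint; congr (_ +i* _); apply: eq_Rintegral => s /set_mem As;
  rewrite fh.
Qed.

Lemma FTC01 (F f : R -> R) : (forall s, I01 s -> is_derive s 1 F (f s)) ->
  {within I01, continuous f} -> Rintegral mu I01 f = F 1 - F 0.
Proof.
move=> dF cf; rewrite /Rintegral (@continuous_FTC2 _ f F 0 1) //=.
- split=> [s|/=|/=].
  + rewrite in_itv /= => /andP[s0 s1].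
    by have /dF [] : I01 s by rewrite /= in_itv /= !ltW.
  + apply: cvg_within_filter; apply/differentiable_continuous/derivable1_diffP.
    by have /dF [] : I01 0 by rewrite /= in_itv /= lexx ler01.
  + apply: cvg_within_filter; apply/differentiable_continuous/derivable1_diffP.
    by have /dF [] : I01 1 by rewrite /= in_itv /= lexx ler01.
- move=> s; rewrite in_itv /= => /andP[s0 s1]; rewrite derive1E.
  have /dF dFs : I01 s by rewrite /= in_itv /= !ltW.
  by rewrite derive_val.
Qed.

Lemma cint_FTC F f : (forall s, I01 s -> is_cder F s (f s)) -> ccont f ->
  cint I01 f = F 1 - F 0.
Proof.
move=> dF /ccont_within [cr ci]; rewrite /cint.
rewrite (FTC01 (fun s As => (dF s As).1) cr) (FTC01 (fun s As => (dF s As).2) ci).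
by case: (F 1) => ? ?; case: (F 0).
Qed.

Lemma ccont_integrable f : ccont f ->
  mu.-integrable I01 (EFin \o (fun s => Re (f s))) /\
  mu.-integrable I01 (EFin \o (fun s => Im (f s))).
Proof.
by move=> /ccont_within [cr ci]; split; apply: continuous_compact_integrable => //;
  apply: segment_compact.
Qed.

Lemma cintD f h : ccont f -> ccont h ->
  cint I01 (fun s => f s + h s) = cint I01 f + cint I01 h.
Proof.
move=> /ccont_integrable [fr fi] /ccont_integrable [hr hi]; rewrite /cint.
have -> : (fun t => Re (f t + h t)) = fun t => Re (f t) + Re (h t).
  by apply/funext => t; rewrite ReD.
have -> : (fun t => Im (f t + h t)) = fun t => Im (f t) + Im (h t).
  by apply/funext => t; rewrite ImD.
by rewrite !RintegralD.
Qed.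

Lemma cintZ c f : ccont f -> cint I01 (fun s => c * f s) = c * cint I01 f.
Proof.
move=> /ccont_integrable [fr fi]; rewrite /cint.
have mI : measurable I01 by [].
have h r k : mu.-integrable I01 (EFin \o k) -> mu.-integrable I01 (EFin \o (fun t => r * k t : R)).
  move=> ik; rewrite (_ : _ \o _ = fun t => (r%:E * (EFin \o k) t)%E); first exact: integrableZl.
  by apply/funext => t; rewrite /= EFinM.
have -> : (fun t => Re (c * f t)) = fun t => Re c * Re (f t) - Im c * Im (f t).
  by apply/funext => t; rewrite ReM.
have -> : (fun t => Im (c * f t)) = fun t => Re c * Im (f t) + Im c * Re (f t).
  by apply/funext => t; rewrite ImM.
rewrite RintegralB ?RintegralD ?RintegralZl //; try exact: h.
by case: c.
Qed.

Lemma cint0 (A : set R) : cint A (fun=> 0) = 0 :> C.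
Proof.
have h : Rintegral mu A (fun=> 0) = 0.
  by rewrite /Rintegral integral0.
by rewrite /cint /= h.
Qed.

Lemma cint_sum n (f : 'I_n -> R -> C) : (forall i, ccont (f i)) ->
  cint I01 (fun s => \sum_i f i s) = \sum_i cint I01 (f i).
Proof.
elim: n f => [|n IH] f cf.
  by rewrite (@cint_eq _ _ (fun=> 0)) ?cint0 ?big_ord0 // => s _; rewrite big_ord0.
rewrite (@cint_eq _ _ (fun s => f ord0 s + \sum_(i < n) f (lift ord0 i) s)); last first.
  by move=> s _; rewrite big_ord_recl.
rewrite cintD //; last exact: ccont_sum.
by rewrite (IH (fun i => f (lift ord0 i))) // big_ord_recl.
Qed.

(** The constant 2 comes from bounding real and imaginary part separately by [B] on an interval of
    length 1. *)
Lemma normc_cint f (B : R) : ccont f -> (forall s, I01 s -> normc (f s) <= B) ->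
  normc (cint I01 f) <= 2 * B.
Proof.
move=> cf fB; have [fr fi] := ccont_integrable cf; have mI : measurable I01 by [].
have H (k : R -> R) : mu.-integrable I01 (EFin \o k) -> (forall s, I01 s -> `|k s| <= B) ->
    `|Rintegral mu I01 k| <= B.
  move=> ik kB.
  have ic (c : R) : mu.-integrable I01 (EFin \o cst c).
    by apply: continuous_compact_integrable; [exact: segment_compact|move=> x; apply: cvg_cst].
  have cE (c : R) : Rintegral mu I01 (cst c) = c.
    transitivity (c * fine (mu I01)); first exact: Rintegral_cst.
    by rewrite lebesgue_measure_itv /= lte_fin ltr01 /= subr0 mulr1.
  have L : Rintegral mu I01 (cst (- B)) <= Rintegral mu I01 k.
    by apply: le_Rintegral => //; [exact: ic|move=> s /kB; rewrite /= ler_norml => /andP[]].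
  have U : Rintegral mu I01 k <= Rintegral mu I01 (cst B).
    by apply: le_Rintegral => //; [exact: ic|move=> s /kB; rewrite /= ler_norml => /andP[]].
  by rewrite cE in L; rewrite cE in U; rewrite ler_norml L U.
apply: le_trans (normc_ReIm _) _; rewrite /cint /= mulr2n mulrDl mul1r.
apply: lerD; apply: H => // s As.
  exact: le_trans (Re_normc _) (fB _ As).
exact: le_trans (Im_normc _) (fB _ As).
Qed.

Lemma ccont_bounded f : ccont f -> exists2 B : R, 0 <= B & forall s, I01 s -> normc (f s) <= B.
Proof.
move=> cf; have [|c _ h] := @EVT_max R (fun s => `|Re (f s)| + `|Im (f s)|) 0 1 ler01.
  apply/subspace_continuousP => s /cf [fr fi].
  by apply: cvgD; apply: cvg_norm.
exists (`|Re (f c)| + `|Im (f c)|); first by rewrite addr_ge0.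
move=> s As; apply: le_trans (normc_ReIm _) _; exact: h.
Qed.

(* The exponential series converges uniformly on the bounded range of [f]. *)
Lemma cint_exp_series f h u : ccont f -> ccont h ->
  has_csum (fun m => cint I01 (fun s => h s * f s ^+ m) * (u ^+ m / m`!%:R))
    (cint I01 (fun s => h s * expC (f s * u))).
Proof.
move=> cf ch; have [rho r0 fr] := ccont_bounded cf; have [B B0 hB] := ccont_bounded ch.
have [T T0 tail] := ebnd_tail 1 (rho * normc u).
have ex s : I01 s -> forall n,
    normc (expC (f s * u) - \sum_(m < n) (f s * u) ^+ m / m`!%:R) <= T n.
  move=> As n; rewrite expCE; apply: tail => m.
  rewrite mul1r normcM normcX normcV normc_nat normcM /exp_coeff /=.
  rewrite ler_wpM2r ?invr_ge0 // lerXn2r ?nnegrE ?mulr_ge0 ?normc_ge0 //.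
  by rewrite ler_wpM2r ?normc_ge0 // fr.
have cm m : ccont (fun s => h s * f s ^+ m) by apply: ccontM => //; apply: ccontX.
have ce : ccont (fun s => h s * expC (f s * u)).
  by apply: ccontM => //; apply/ccont_exp/ccontM => //; apply: ccont_cst.
apply/ctendsP => e e0.
(* The integral of the remainder is at most 2 B T(n); the added 1 keeps the divisor positive when B
   = 0. *)
have e1 : 0 < e / (2 * B + 1) by rewrite divr_gt0 // ltr_wpDl // mulr_ge0.
move/cvgrPdist_lt: T0 => /(_ _ e1); apply: filterS => n.
rewrite sub0r normrN => /(le_lt_trans (ler_norm _)) Tn.
have -> : \sum_(m < n) cint I01 (fun s => h s * f s ^+ m) * (u ^+ m / m`!%:R) =
   cint I01 (fun s => \sum_(m < n) (u ^+ m / m`!%:R) * (h s * f s ^+ m)).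
  rewrite cint_sum; last by move=> i; apply: ccontM => //; apply: ccont_cst.
  by apply: eq_bigr => m _; rewrite cintZ // mulrC.
set S := cint _ (fun s => \sum_(m < n) _).
have -> : S - cint I01 (fun s => h s * expC (f s * u)) =
   cint I01 (fun s => \sum_(m < n) (u ^+ m / m`!%:R) * (h s * f s ^+ m) +
       -1 * (h s * expC (f s * u))).
  rewrite cintD; last 2 first.
  - by apply: ccont_sum => m; apply: ccontM => //; apply: ccont_cst.
  - by apply: ccontM => //; apply: ccont_cst.
  by rewrite cintZ // mulN1r.
apply: le_lt_trans (normc_cint (B := B * T n) _ _) _.
- apply: ccontD; last by apply: ccontM => //; apply: ccont_cst.
  by apply: ccont_sum => m; apply: ccontM => //; apply: ccont_cst.
- move=> s As.
  have -> : \sum_(m < n) u ^+ m / m`!%:R * (h s * f s ^+ m) + -1 * (h s * expC (f s * u)) =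
     - (h s * (expC (f s * u) - \sum_(m < n) (f s * u) ^+ m / m`!%:R)).
    rewrite mulrBr opprB mulN1r mulr_sumr; congr (_ - _).
    by apply: eq_bigr => m _; rewrite exprMn; ring.
  rewrite normcNE normcM; apply: ler_pM; rewrite ?normc_ge0 ?hB //; exact: ex.
- have : T n * (2 * B + 1) < e by rewrite -ltr_pdivlMr // ltr_wpDl // mulr_ge0.
  have T0 : 0 <= T n.
    by apply: le_trans (normc_ge0 _) (ex 0 _ n); rewrite /= in_itv /= lexx ler01.
  by move: T0; nra.
Qed.

End UnitInterval.

(** * The principal logarithm along a path *)

Section Logarithm.
Variable R : realType.
Local Notation C := R[i].
Local Notation Re := (@complex.Re R).
Local Notation Im := (@complex.Im R).

(* Principal branch, off the closed negative real axis. *)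
Definition clog (z : C) : C :=
  (ln (Re z ^+ 2 + Im z ^+ 2) / 2) +i*
  (2 * atan (Im z / (Re z + Num.sqrt (Re z ^+ 2 + Im z ^+ 2)))).

(** With r = |z|, the half-angle formula arg z = 2 atan(y / (x + r)) is one expression smooth
    wherever x + r > 0, that is, on the whole slit plane. *)
Lemma is_cder_clog (f : R -> C) (s : R) (D : C) :
  0 < Re (f s) + normc (f s) -> is_cder f s D ->
  is_cder (fun t => clog (f t)) s (D / f s).
Proof.
move=> pos [fr fi]; pose n t := Re (f t) ^+ 2 + Im (f t) ^+ 2.
have rE : normc (f s) = Num.sqrt (n s) by rewrite normc_sqrt.
have r0 : 0 < Num.sqrt (n s).
  rewrite -rE lt_def normc_ge0 andbT normc_eq0; apply: contraTneq pos => ->.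
  by rewrite normc0 addr0 ltxx.
have n0 : 0 < n s by rewrite -sqrtr_gt0.
have dn : is_derive s 1 n (2 * (Re (f s) * Re D + Im (f s) * Im D)).
  rewrite /n; under eq_fun do rewrite !expr2; apply: is_derive_eq.
  by rewrite /GRing.scale /=; ring.
have dl : is_derive s 1 (fun t => ln (n t)) ((n s)^-1 * (2 * (Re (f s) * Re D + Im (f s) * Im D))).
  by apply: is_derive1_comp => //; apply: is_derive1_ln.
have dr : is_derive s 1 (fun t => Num.sqrt (n t))
    ((2 * Num.sqrt (n s))^-1 * (2 * (Re (f s) * Re D + Im (f s) * Im D))).
  by apply: is_derive1_comp => //; apply: is_derive1_sqrt.
have r2 : Num.sqrt (n s) ^+ 2 = n s by rewrite sqr_sqrtr // ltW.
have yE : Im (f s) ^+ 2 = Num.sqrt (n s) ^+ 2 - Re (f s) ^+ 2 by rewrite r2 /n; ring.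
move: pos; rewrite rE => pos.
have x0 : Re (f s) + Num.sqrt (n s) != 0 by rewrite gt_eqF.
have dV : is_derive s 1 (fun t => (Re (f t) + Num.sqrt (n t))^-1)
   (- (Re (f s) + Num.sqrt (n s)) ^- 2 * (Re D +
     (2 * Num.sqrt (n s))^-1 * (2 * (Re (f s) * Re D + Im (f s) * Im D)))).
  exact: is_deriveV.
have f0 : f s != 0.
  by rewrite -normc_eq0 rE gt_eqF.
have DE : D / f s = ((Re D * Re (f s) + Im D * Im (f s)) / n s) +i*
    ((Im D * Re (f s) - Re D * Im (f s)) / n s).
  apply: (mulIf f0); rewrite divfK //; move: n0; rewrite /n.
  case: (f s) => a b /=; case: {dn dl dr dV fr fi} D => x y /= n0.
  apply/eqP; rewrite eq_complex /=; apply/andP; split; apply/eqP; field; by rewrite gt_eqF.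
rewrite DE; split; rewrite /clog /=.
  by apply: is_derive_eq; rewrite /GRing.scale /=; field; rewrite gt_eqF.
have dA : is_derive s 1 (fun t => atan (Im (f t) / (Re (f t) + Num.sqrt (n t))))
   ((1 + (Im (f s) / (Re (f s) + Num.sqrt (n s))) ^+ 2)^-1 *
    (Im (f s) * (- (Re (f s) + Num.sqrt (n s)) ^- 2 * (Re D +
     (2 * Num.sqrt (n s))^-1 * (2 * (Re (f s) * Re D + Im (f s) * Im D)))) +
     (Re (f s) + Num.sqrt (n s))^-1 * Im D)).
  apply: (@is_derive1_comp _ atan (fun t => Im (f t) / (Re (f t) + Num.sqrt (n t)))).
  by apply: is_derive_eq; rewrite /GRing.scale /=; ring.
apply: (is_derive_eq (is_deriveZ 2 dA)); rewrite /GRing.scale /= -[in RHS]r2.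
move: r0 x0 yE; move: (Num.sqrt (n s)) (Re (f s)) (Im (f s)) (Re D) (Im D).
move=> r x y x' y' r0 x0 yE; have {}r0 : r != 0 by rewrite gt_eqF.
(* From y^2 = r^2 - x^2 the numerator (x + r)^2 + y^2 equals 2 r (x + r). *)
have -> : 1 + (y / (x + r)) ^+ 2 = 2 * r / (x + r).
  by rewrite exprMn exprVn yE; field.
have -> : y * (- (x + r) ^- 2 * (x' + (2 * r)^-1 * (2 * (x * x' + y * y')))) =
   - (x + r) ^- 2 * ((r + x) * (y * x') + y ^+ 2 * y') / r.
  by field; rewrite r0 x0.
rewrite yE; field; by rewrite r0 x0.
Qed.

End Logarithm.

(** * Integrals around the loop by primitives and partial fractions *)

Section Contour.
Variable R : realType.
Local Notation C := R[i].
Local Notation Re := (@complex.Re R).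
Local Notation Im := (@complex.Im R).
Local Notation I01 := (`[0, 1]%classic : set R).
Variables (g : R -> C) (gl : C1_loop g).
Implicit Types f h : C -> C.

Lemma loop_der s : I01 s -> is_cder g s (cderiv g s).
Proof.
move=> Is; have [_ /(_ s (mem_set Is)) [d1 d2] _] := gl.
by split; rewrite /cderiv /= derive1E; apply/derivableP.
Qed.

Lemma ccont_loop : ccont g. Proof. exact: is_cder_ccont loop_der. Qed.

Lemma ccont_cderiv : ccont (cderiv g).
Proof.
have [_ _ [c1 c2]] := gl; move=> s Is.
by split; [move/subspace_continuousP: c1|move/subspace_continuousP: c2]; apply.
Qed.

Let cc f := ccont (fun s => f (g s)).

Lemma contour_eq f h : (forall s, I01 s -> f (g s) = h (g s)) ->
  contour_int g f = contour_int g h.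
Proof. by move=> fh; apply: cint_eq => s Is; rewrite fh. Qed.

Lemma contour_lin a b f h : cc f -> cc h ->
  contour_int g (fun z => a * f z + b * h z) = a * contour_int g f + b * contour_int g h.
Proof.
move=> cf ch; have cd := ccont_cderiv.
have cf' := ccontM cf cd; have ch' := ccontM ch cd.
rewrite /contour_int -!cintZ // -cintD; last 2 first.
- by apply: ccontM => //; apply: ccont_cst.
- by apply: ccontM => //; apply: ccont_cst.
by apply: cint_eq => s _; ring.
Qed.

(** The primitive is a function of the loop parameter, so it need exist only along the loop; this
    admits a branch of the logarithm. *)
Lemma contour_exact (F : R -> C) f : cc f ->
  (forall s, I01 s -> is_cder F s (f (g s) * cderiv g s)) -> F 0 = F 1 ->
  contour_int g f = 0.
Proof.
move=> cf dF F01; rewrite /contour_int (cint_FTC dF) ?F01 ?subrr //.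
exact: ccontM cf ccont_cderiv.
Qed.

Let g01 : g 0 = g 1. Proof. by case: gl. Qed.

Lemma contour_pow m : contour_int g (fun z => z ^+ m) = 0.
Proof.
apply: (@contour_exact (fun s => m.+1%:R^-1 * g s ^+ m.+1)); last by rewrite g01.
  exact: ccontX ccont_loop.
move=> s Is; apply: is_cder_eq (is_cderZ _ (is_cderX m.+1 (loop_der Is))) _.
by rewrite /= -mulrA mulKf // pnatr_eq0.
Qed.

Definition avoids (a : C) := forall s, I01 s -> g s != a.

Lemma cc_pole a : avoids a -> cc (fun z => (z - a)^-1).
Proof.
move=> ga; apply: ccontV => [s Is|]; first by rewrite subr_eq0 ga.
by apply: ccontD; [exact: ccont_loop|exact: ccont_cst].
Qed.

Lemma contour_invpow a n : avoids a ->
  contour_int g (fun z => ((z - a)^-1) ^+ n.+2) = 0.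
Proof.
move=> ga.
apply: (@contour_exact (fun s => - n.+1%:R^-1 * ((g s - a)^-1) ^+ n.+1)); last by rewrite g01.
  exact: ccontX (cc_pole ga).
move=> s Is; have ga0 : g s - a != 0 by rewrite subr_eq0 ga.
have d1 := is_cderD (loop_der Is) (is_cder_cst (- a) s).
apply: is_cder_eq (is_cderZ _ (is_cderX n.+1 (is_cderV ga0 d1))) _ => /=.
have n0 : n.+1%:R != 0 :> C by rewrite pnatr_eq0.
rewrite addr0 -[in RHS]addn2 exprD !exprVn.
by field; rewrite ga0 expf_neq0 // nat1r n0.
Qed.

(** Induction on the number of poles. If they all coincide, a power of order at least two has a
    primitive. Otherwise partial fractions at two distinct poles [a] and [b'] give a multiple of the
    difference of two products with one pole fewer, and these have equal integrals because every
    pole has the same value [w]. *)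
Lemma contour_poles (w : C) (r : seq C) :
  (forall a, a \in r -> avoids a /\ contour_int g (fun z => (z - a)^-1) = w) ->
  r != [::] ->
  contour_int g (fun z => \prod_(a <- r) (z - a)^-1) = (size r == 1%N)%:R * w.
Proof.
have [k] := ubnP (size r); elim: k r => // k IH [//|a r] /= sr hr _.
have [ga aw] := hr a (mem_head _ _).
case: r => [|b r] in sr hr *.
  rewrite mul1r -aw; apply: contour_eq => s _; by rewrite big_seq1.
rewrite mul0r.
have [all_a|/allPn [b' b'r b'a]] := boolP (all (pred1 a) (b :: r)).
  rewrite -(contour_invpow (size r) ga); apply: contour_eq => s _.
  have -> : a :: b :: r = nseq (size r).+2 a.
    by apply/(@all_pred1P _ a [:: a, b & r]); rewrite /= eqxx; exact: all_a.
  rewrite big_nseq; elim: (_.+2) => [|n]; first by rewrite expr0.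
  by rewrite iterS => ->; rewrite exprS.
have P : perm_eq (b :: r) (b' :: rem b' (b :: r)) by apply: perm_to_rem.
set r' := rem b' (b :: r) in P.
have sz : size r' = size r by rewrite size_rem //.
have inr' c : c \in r' -> c \in b :: r by rewrite (perm_mem P) in_cons => ->; rewrite orbT.
have inb : b' \in [:: a, b & r] by rewrite in_cons b'r orbT.
have [gb bw] := hr b' inb.
have ab : a - b' != 0 by rewrite subr_eq0 eq_sym.
have cp c : c \in a :: b :: r -> cc (fun z => \prod_(a <- c :: r') (z - a)^-1).
  move=> cr s Is; apply: (@ctends_near_eq _ _ _ _ (fun s =>
    \prod_(i < size (c :: r')) (g s - nth 0 (c :: r') i)^-1)).
    by apply: nearW => t; rewrite [RHS](big_nth 0) big_mkord.
  rewrite (big_nth 0) big_mkord; apply: ctends_prod => i _.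
  have [gi _] : avoids (nth 0 (c :: r') i) /\ contour_int g (fun z => (z - nth 0 (c :: r') i)^-1) = w.
    apply: hr; have := mem_nth 0 (ltn_ord i); rewrite in_cons => /orP[/eqP->//|/inr' h].
    by rewrite in_cons h orbT.
  exact: cc_pole.
have IHc c : c \in a :: b :: r -> contour_int g (fun z => \prod_(a <- c :: r') (z - a)^-1) =
    (size (c :: r') == 1%N)%:R * w.
  move=> cr; apply: IH => //; first by rewrite /= sz.
  move=> x; rewrite in_cons => /orP[/eqP->|/inr' xr]; apply: hr => //.
  by rewrite in_cons xr orbT.
have -> : contour_int g (fun z => \prod_(c <- [:: a, b & r]) (z - c)^-1) =
   contour_int g (fun z => (a - b')^-1 * \prod_(c <- a :: r') (z - c)^-1 +
      (- (a - b')^-1) * \prod_(c <- b' :: r') (z - c)^-1).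
  apply: contour_eq => s Is; rewrite big_cons (perm_big _ P) /= !big_cons.
  have ga0 : g s - a != 0 by rewrite subr_eq0 ga.
  have gb0 : g s - b' != 0 by rewrite subr_eq0 gb.
  by field; rewrite ab ga0 gb0.
have ina : a \in [:: a, b & r] by rewrite mem_head.
by rewrite contour_lin ?IHc //=; [ring|exact: cp|exact: cp].
Qed.

Section Nodes.
Variables (N : nat) (x : nat -> C) (w : C).
Hypothesis hx : forall s, (s < N)%N ->
  avoids (x s) /\ contour_int g (fun z => (z - x s)^-1) = w.

Lemma cc_poles q : (q <= N)%N -> cc (fun z => \prod_(s < q) (z - x s)^-1).
Proof.
move=> qN t It; apply: ctends_prod => s _.
by have [/cc_pole h _] := hx (leq_trans (ltn_ord s) qN); apply: h.
Qed.

(** Cauchy's formula for divided differences. Writing one factor z as (z - x_q) + x_q reproduces the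
    recurrence that defines [ddm], and [contour_poles] gives its start m = 0. *)
Lemma contour_newton m q : (q < N)%N ->
  contour_int g (fun z => z ^+ m * \prod_(s < q.+1) (z - x s)^-1) = w * ddm x m q.
Proof.
have cX n : cc (fun z => z ^+ n) by exact: ccontX ccont_loop.
elim: m q => [|m IH] q qN.
  have -> : contour_int g (fun z => z ^+ 0 * \prod_(s < q.+1) (z - x s)^-1) =
     contour_int g (fun z => \prod_(a <- [seq x i | i <- iota 0 q.+1]) (z - a)^-1).
    apply: contour_eq => s _; rewrite expr0 mul1r big_map.
    by rewrite -(big_mkord predT (fun i => (g s - x i)^-1)) /index_iota subn0.
  rewrite (contour_poles (w := w)) //.
    by rewrite size_map size_iota eqSS mulrC.
  move=> a /mapP[i iq aE]; rewrite aE; move: iq; rewrite mem_iota add0n => /andP[_ iq].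
  by apply: hx; apply: leq_trans iq _.
have [gq wq] := hx qN.
have -> : contour_int g (fun z => z ^+ m.+1 * \prod_(s < q.+1) (z - x s)^-1) =
  contour_int g (fun z => 1 * (z ^+ m * \prod_(s < q) (z - x s)^-1) +
     x q * (z ^+ m * \prod_(s < q.+1) (z - x s)^-1)).
  apply: contour_eq => s Is; rewrite exprS !big_ord_recr /=.
  have g0 : g s - x q != 0 by rewrite subr_eq0 gq.
  by field.
rewrite contour_lin; last 2 first.
- by apply: ccontM; [exact: cX|apply: cc_poles; exact: ltnW].
- by apply: ccontM; [exact: cX|exact: cc_poles].
rewrite IH // mul1r mulrDr mulrCA /=; congr (_ + _).
case: q qN {gq wq} => [|q] qN; last by apply: IH; apply: ltnW.
rewrite mulr0 -(contour_pow m); apply: contour_eq => s _.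
by rewrite big_ord0 mulr1.
Qed.

End Nodes.

Section Ray.
Variables (w d : C).
Hypothesis d0 : d != 0.
Hypothesis ray : forall s (t : R), I01 s -> 0 <= t -> g s != w + t%:C * d.

Lemma ray_avoids : avoids w.
Proof. by move=> s Is; have := ray Is (lexx 0); rewrite mul0r addr0. Qed.

Lemma contour_ray0 : contour_int g (fun z => (z - w)^-1) = 0.
Proof.
(* This rotation and scaling sends the ray from [w] to the closed negative real axis, the cut of
   [clog]. *)
pose q s := - d^-1 * (g s - w).
apply: (@contour_exact (fun s => clog (q s))); last by rewrite /q g01.
  exact: cc_pole ray_avoids.
move=> s Is; have g0 : g s - w != 0 by rewrite subr_eq0 ray_avoids.
have d1 := is_cderZ (- d^-1) (is_cderD (loop_der Is) (is_cder_cst (- w) s)).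
apply: is_cder_eq (is_cder_clog _ d1) _; last by field; rewrite g0 d0.
(* Were Re q + |q| <= 0, then q would be a real number - t with t >= 0, and the loop would meet the
   ray at w + t d. *)
rewrite -/(q s) ltNge; apply/negP => le0.
have : normc (q s) <= - Re (q s) by rewrite -subr_le0 opprK addrC.
move=> le1; have re0 : Re (q s) <= 0 by have := normc_ge0 (q s); move: le1; lra.
have im0 : Im (q s) = 0.
  apply/eqP; rewrite -sqrf_eq0; apply/eqP.
  have : normc (q s) ^+ 2 <= (- Re (q s)) ^+ 2.
    by rewrite lerXn2r ?nnegrE ?normc_ge0 // oppr_ge0.
  rewrite normc_sqrt sqr_sqrtr ?addr_ge0 ?sqr_ge0 // sqrrN gerDl => h.
  by apply/eqP; rewrite eq_le h sqr_ge0.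
have /negP := ray Is (t := - Re (q s)) ltac:(by rewrite oppr_ge0); apply; apply/eqP.
have -> : (- Re (q s))%:C = - q s.
  by move: im0; case: (q s) => a b /= ->; apply/eqP; rewrite eq_complex /= oppr0 !eqxx.
by rewrite /q; field.
Qed.

(** Induction through z / (w - z) = w / (w - z) - 1, the monomials having integral zero. *)
Lemma contour_ray m : contour_int g (fun z => (w - z)^-1 * z ^+ m) = 0.
Proof.
have gw := ray_avoids.
have cX n : cc (fun z => z ^+ n) by exact: ccontX ccont_loop.
have cw : cc (fun z => (w - z)^-1).
  apply: ccontV => [s Is|]; first by rewrite subr_eq0 eq_sym gw.
  by apply: ccontD; [exact: ccont_cst|exact: ccontN ccont_loop].
elim: m => [|m IH].
  have := contour_lin (-1) 0 (cc_pole gw) (cX 0); rewrite contour_ray0 mulr0 mul0r addr0 => <-.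
  apply: contour_eq => s Is; have g0 : g s - w != 0 by rewrite subr_eq0 gw.
  rewrite expr0; field; rewrite g0 /= subr_eq0 eq_sym gw //.
have := @contour_lin w (-1) (fun z => (w - z)^-1 * z ^+ m) (fun z => z ^+ m)
  (ccontM cw (cX m)) (cX m).
rewrite IH contour_pow !mulr0 addr0 => <-.
apply: contour_eq => s Is; rewrite exprS; field.
by rewrite subr_eq0 eq_sym gw.
Qed.

End Ray.

End Contour.

(** * The inner contour integral *)

Section ContourValue.
Variable R : realType.
Local Notation C := R[i].
Local Notation I01 := (`[0, 1]%classic : set R).
Variables (g : R -> C) (gl : C1_loop g).

(** Each new factor is (w - x_n) / (z - x_n) = 1 + (w - z) / (z - x_n). The factor w - z in front of
    the sum is what cancels the kernel 1 / (w - z). *)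
Lemma newton_telescope (x : nat -> C) (w z : C) n :
  (forall s, (s < n)%N -> z != x s) ->
  \prod_(s < n) ((w - x s) / (z - x s)) =
  1 + (w - z) * \sum_(q < n) newton x q w * \prod_(s < q.+1) (z - x s)^-1.
Proof.
elim: n => [|n IH] zx; first by rewrite !big_ord0 mulr0 addr0.
have z0 : z - x n != 0 by rewrite subr_eq0 zx.
have E : newton x n w * \prod_(s < n) (z - x s)^-1 = \prod_(s < n) ((w - x s) / (z - x s)).
  by rewrite -big_split.
have E' : newton x n w * \prod_(s < n.+1) (z - x s)^-1 =
    (\prod_(s < n) ((w - x s) / (z - x s))) / (z - x n).
  by rewrite big_ord_recr /= mulrA E.
rewrite big_ord_recr [X in _ = 1 + _ * X]big_ord_recr /= E' mulrDr addrA -IH; last first.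
  by move=> s sn; apply: zx; apply: ltnW.
by field.
Qed.

Lemma contour_exp_series (h : C -> C) u : ccont (fun s => h (g s)) ->
  has_csum (fun m => contour_int g (fun z => h z * z ^+ m) * (u ^+ m / m`!%:R))
    (contour_int g (fun z => h z * expC (z * u))).
Proof.
move=> ch.
have := cint_exp_series u (ccont_loop gl) (ccontM ch (ccont_cderiv gl)).
have -> : cint I01 (fun s => h (g s) * cderiv g s * expC (g s * u)) =
   contour_int g (fun z => h z * expC (z * u)).
  by apply: cint_eq => s _; ring.
congr has_csum; apply/funext => m; congr (_ * _).
by apply: cint_eq => s _; ring.
Qed.

Lemma contour_sum n (c : 'I_n -> C) (f : 'I_n -> C -> C) :
  (forall i, ccont (fun s => f i (g s))) ->
  contour_int g (fun z => \sum_i c i * f i z) = \sum_i c i * contour_int g (f i).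
Proof.
move=> cf; have cfd i := ccontM (cf i) (ccont_cderiv gl).
transitivity (cint I01 (fun s => \sum_i c i * (f i (g s) * cderiv g s))).
  by apply: cint_eq => s _; rewrite mulr_suml; apply: eq_bigr => i _; ring.
rewrite cint_sum; first by apply: eq_bigr => i _; rewrite cintZ.
by move=> i; apply: ccontM => //; apply: ccont_cst.
Qed.

Lemma contour_einterp N (l : 'I_N -> R) (om u v w d : C) : d != 0 ->
  (forall i, avoids g (l i)%:C /\ contour_int g (fun z => (z - (l i)%:C)^-1) = om) ->
  (forall s (t : R), I01 s -> 0 <= t -> g s != w + t%:C * d) ->
  contour_int g (fun z => (w - z)^-1 * (expC (z * u) / expC (w * v)) *
    \prod_(i < N) ((w - (l i)%:C) / (z - (l i)%:C))) =
  om * ((einterp l u).[w] * expC (- (w * v))).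
Proof.
move=> d0 hl ray; set x := lnode l.
have xE (i : 'I_N) : x i = (l i)%:C by rewrite /x /lnode ext_ord.
have hx s : (s < N)%N -> avoids g (x s) /\ contour_int g (fun z => (z - x s)^-1) = om.
  by move=> sN; rewrite -[s]/(nat_of_ord (Ordinal sN)) xE.
have gw := ray_avoids ray.
pose P q z := \prod_(s < q) (z - x s)^-1.
have cP q : (q <= N)%N -> ccont (fun s => P q (g s)) by move=> qN; exact: (cc_poles gl hx qN).
have ce : ccont (fun s => expC (g s * u)).
  by apply: ccont_exp; apply: ccontM; [exact: ccont_loop|exact: ccont_cst].
have cw : ccont (fun s => (w - g s)^-1).
  apply: ccontV => [s Is|]; first by rewrite subr_eq0 eq_sym gw.
  by apply: ccontD; [exact: ccont_cst|apply: ccontN; exact: ccont_loop].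
have cPe (q : 'I_N) : ccont (fun s => P q.+1 (g s) * expC (g s * u)).
  by apply: ccontM => //; apply: cP.
transitivity (contour_int g (fun z => expC (- (w * v)) * ((w - z)^-1 * expC (z * u)) +
   expC (- (w * v)) * \sum_(q < N) newton x q w * (P q.+1 z * expC (z * u)))).
  apply: contour_eq => s Is; rewrite expCN.
  have -> : \prod_(i < N) ((w - (l i)%:C) / (g s - (l i)%:C)) =
      \prod_(i < N) ((w - x i) / (g s - x i)).
    by apply: eq_bigr => i _; rewrite xE.
  rewrite newton_telescope; last by move=> i /hx [h _]; apply: h.
  have w0 : w - g s != 0 by rewrite subr_eq0 eq_sym gw.
  have -> : \sum_(q < N) newton x q w * (P q.+1 (g s) * expC (g s * u)) =
     (\sum_(q < N) newton x q w * \prod_(s0 < q.+1) (g s - x s0)^-1) * expC (g s * u).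
    by rewrite mulr_suml; apply: eq_bigr => q _; rewrite mulrA.
  by field; rewrite w0 expC_neq0.
rewrite (@contour_lin _ _ gl _ _ (fun z => (w - z)^-1 * expC (z * u))
  (fun z => \sum_(q < N) newton x q w * (P q.+1 z * expC (z * u)))); last 2 first.
- exact: ccontM.
- by apply: ccont_sum => q; apply: ccontM; [exact: ccont_cst|exact: cPe].
(* Every term of the exponential series integrates to zero against 1 / (w - z). *)
have -> : contour_int g (fun z => (w - z)^-1 * expC (z * u)) = 0.
  have := @contour_exp_series (fun z => (w - z)^-1) u cw.
  have -> : (fun m => contour_int g (fun z => (w - z)^-1 * z ^+ m) * (u ^+ m / m`!%:R)) = fun=> 0.
    by apply/funext => m; rewrite (contour_ray gl d0 ray) mul0r.
  move=> /has_csumE <-; apply: has_csumE; exact: (@has_csum1 _ (fun=> 0) 0).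
rewrite mulr0 add0r contour_sum // mulrA mulrC /einterp horner_sum; congr (_ * _).
rewrite mulr_sumr; apply: eq_bigr => q _; rewrite hornerZ newtonP_horner mulrA [RHS]mulrC.
congr (_ * _).
(* Termwise, the integral of z^m against the first q + 1 inverse poles is [om] times [ddm x m q];
   summing over m gives [om] times [ecoef u q]. *)
have := contour_exp_series (h := P q.+1) u (cP _ (ltn_ord q)).
have -> : (fun m => contour_int g (fun z => P q.+1 z * z ^+ m) * (u ^+ m / m`!%:R)) =
   fun m => om * (ddm x m q * (u ^+ m / m`!%:R)).
  apply/funext => m; rewrite [RHS]mulrA -(contour_newton gl hx m (ltn_ord q)); congr (_ * _).
  by apply: contour_eq => s _; rewrite mulrC.
by move=> /has_csumE <-; apply: has_csumE; apply/has_csumZ/ecoef_has_csum.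
Qed.

End ContourValue.

(** * The integral along the ray *)

Section RayIntegral.
Variable R : realType.
Local Notation C := R[i].
Local Notation Re := (@complex.Re R).
Local Notation Im := (@complex.Im R).
Local Notation mu := (@lebesgue_measure R).
Local Notation Iy := (`[0, +oo[%classic : set R).

Lemma cvg_expR_decay (c K : R) : 0 < c -> K * expR (- (c * t)) @[t --> +oo] --> 0.
Proof.
move=> c0; rewrite -[X in _ --> X](mulr0 K); apply: cvgM; first exact: cvg_cst.
apply/cvgrPdist_lt => e e0; near=> t.
have te : (c * e)^-1 < t by near: t; apply: nbhs_pinfty_gt; rewrite num_real.
have ct : 0 < c * t by rewrite mulr_gt0 // (lt_trans _ te) // invr_gt0 mulr_gt0.
rewrite sub0r normrN ger0_norm ?expR_ge0 // expRN.
rewrite -[ltRHS]invrK ltf_pV2 ?posrE ?expR_gt0 ?invr_gt0 //.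
apply: lt_le_trans (expR_ge1Dx _); rewrite ltr_pwDl // ltW //.
rewrite -ltr_pdivrMl // -invfM mulrC; move: te; rewrite invfM.
by rewrite [_^-1 * _]mulrC -invfM mulrC.
Unshelve. all: by end_near. Qed.

Lemma FTCy_ge0_integrable (F f : R -> R) : (forall t : R, is_derive t 1 F (f t)) ->
  continuous f -> (forall t, 0 <= t -> 0 <= f t) -> F t @[t --> +oo] --> 0 ->
  mu.-integrable Iy (EFin \o f) /\ Rintegral mu Iy f = - F 0.
Proof.
move=> dF cf f0 Fy.
have cfw : {within Iy, continuous f} by apply: continuous_subspaceT.
have H : (\int[mu]_(x in Iy) (f x)%:E = 0%:E - (F 0)%:E)%E.
  apply: (ge0_continuous_FTC2y f0 cfw Fy).
  - by move=> t _; have [] := dF t.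
  - apply: cvg_within_filter; apply/differentiable_continuous/derivable1_diffP.
    by have [] := dF 0.
  - by move=> t _; rewrite derive1E derive_val.
split; last by rewrite /Rintegral H /= sub0r.
apply/integrableP; split.
  by apply/measurable_EFinP; apply: subspace_continuous_measurable_fun.
under eq_integral => t.
  rewrite inE /= in_itv /= andbT => t0.
  rewrite ger0_norm ?f0 //; over.
by rewrite /= H -EFinB ltry.
Qed.

(** The signed integrand is reduced to nonnegative ones: [f + k] and [k] are both nonnegative for
    the majorant k(t) = K exp(- c t), whose primitive [G] is explicit, and the two integrals are
    subtracted. *)
Lemma FTCy_decay (F f : R -> R) (c K : R) : 0 < c ->
  (forall t : R, is_derive t 1 F (f t)) -> continuous f ->
  (forall t, 0 <= t -> `|f t| <= K * expR (- (c * t))) ->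
  F t @[t --> +oo] --> 0 -> Rintegral mu Iy f = - F 0.
Proof.
move=> c0 dF cf fK Fy.
pose k t := K * expR (- (c * t)); pose G t := - (K / c) * expR (- (c * t)).
have de (t : R) : is_derive t 1 (fun t => expR (- (c * t))) (expR (- (c * t)) * - c).
  apply: (@is_derive1_comp _ expR (fun t => - (c * t))).
  by apply: is_derive_eq; rewrite /GRing.scale /= mulr1.
have dG (t : R) : is_derive t 1 G (k t).
  apply: (is_derive_eq (is_deriveZ (- (K / c)) (de t))).
  by rewrite /k /GRing.scale /=; field; rewrite gt_eqF.
have ck : continuous k.
  move=> t; apply: cvgM; first exact: cvg_cst.
  have [dt _] := de t; exact: (differentiable_continuous (proj1 (derivable1_diffP _ _) dt)).
have k0 t : 0 <= t -> 0 <= k t by move=> /fK; apply: le_trans.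
have Gy : G t @[t --> +oo] --> 0 by apply: cvg_expR_decay.
have [ik Ik] := FTCy_ge0_integrable dG ck k0 Gy.
have [ih Ih] : mu.-integrable Iy (EFin \o (fun t => f t + k t)) /\
    Rintegral mu Iy (fun t => f t + k t) = - (F 0 + G 0).
  apply: (FTCy_ge0_integrable (F := fun t => F t + G t)).
  - by move=> t; apply: cvgD; [exact: cf|exact: ck].
  - by move=> t t0; move: (fK _ t0); rewrite ler_norml -/(k t) => /andP[+ _]; lra.
  - by rewrite -[X in _ --> X](addr0 0); apply: cvgD.
have -> : f = fun t => (f t + k t) - k t by apply/funext => t; rewrite addrK.
rewrite RintegralB // Ih Ik; ring.
Qed.

(** Growth below every exponential. Quantifying over all rates [c] makes the class stable under
    products, each factor taking half of the rate. *)
Definition subexp (f : R -> C) := forall c : R, 0 < c ->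
  exists2 K : R, 0 <= K & forall t, 0 <= t -> normc (f t) <= K * expR (c * t).

Lemma subexp_cst a : subexp (fun=> a).
Proof.
move=> c c0; exists (normc a); first exact: normc_ge0.
move=> t t0; rewrite ler_peMr ?normc_ge0 //.
by apply: le_trans (expR_ge1Dx _); rewrite lerDl mulr_ge0 // ltW.
Qed.

Lemma subexpD f h : subexp f -> subexp h -> subexp (fun t => f t + h t).
Proof.
move=> sf sh c c0; have [K K0 hK] := sf c c0; have [L L0 hL] := sh c c0.
exists (K + L); first exact: addr_ge0.
move=> t t0; apply: le_trans (normcD _ _) _; rewrite mulrDl.
exact: lerD (hK _ t0) (hL _ t0).
Qed.

Lemma subexpM f h : subexp f -> subexp h -> subexp (fun t => f t * h t).
Proof.
move=> sf sh c c0; have c2 : 0 < c / 2 by rewrite divr_gt0.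
have [K K0 hK] := sf _ c2; have [L L0 hL] := sh _ c2.
exists (K * L); first exact: mulr_ge0.
move=> t t0; rewrite normcM; apply: le_trans (ler_pM _ _ (hK _ t0) (hL _ t0)) _.
- exact: normc_ge0.
- exact: normc_ge0.
rewrite mulrACA -expRD -mulrDl -splitr //.
Qed.

Lemma subexp_id : subexp (fun t => t%:C).
Proof.
move=> c c0; exists c^-1; first by rewrite invr_ge0 ltW.
move=> t t0; rewrite normc_real ger0_norm // ler_pdivlMl //.
by apply: le_trans (expR_ge1Dx _); rewrite lerDr.
Qed.

Lemma subexp_horner (P : {poly C}) (p d : C) : subexp (fun t => P.[p + t%:C * d]).
Proof.
elim/poly_ind: P => [|P a IH].
  by under eq_fun do rewrite horner0; apply: subexp_cst.
under eq_fun do rewrite hornerMXaddC.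
apply: subexpD; last exact: subexp_cst.
apply: subexpM => //; apply: subexpD; first exact: subexp_cst.
by apply: subexpM; [exact: subexp_id|exact: subexp_cst].
Qed.

(** The exponential decays at rate Re(d v) = 2 c; the polynomial costs a rate c, and the rate c
    remains. *)
Lemma horner_exp_decay (P : {poly C}) (p d v : C) (c := Re (d * v) / 2) :
  0 < Re (d * v) -> exists K : R, forall t, 0 <= t ->
  normc (P.[p + t%:C * d] * expC (- ((p + t%:C * d) * v))) <= K * expR (- (c * t)).
Proof.
move=> dv; have c0 : 0 < c by rewrite divr_gt0.
have [K K0 hK] := subexp_horner P p d c0.
exists (K * expR (- Re (p * v))) => t t0.
rewrite normcM normc_expC.
have -> : Re (- ((p + t%:C * d) * v)) = - Re (p * v) - 2 * (c * t).
  by rewrite mulrDl -mulrA ReN ReD [Re (t%:C * _)]ReM /= mul0r subr0 /c; field.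
apply: (@le_trans _ _ (K * expR (c * t) * expR (- Re (p * v) - 2 * (c * t)))).
  by rewrite ler_wpM2r ?expR_ge0 // hK.
rewrite -!mulrA -!expRD ler_wpM2l // ler_expR; lra.
Qed.

(** Along the ray, - Q(w) exp(- w v) is a primitive of the integrand, because v Q - Q' = P, and it
    decays at infinity; only its value at w = p contributes. *)
Lemma cint_ray (P Q : {poly C}) (p d v : C) : 0 < Re (d * v) ->
  v *: Q - deriv Q = P ->
  cint Iy (fun t => d * (P.[p + t%:C * d] * expC (- ((p + t%:C * d) * v)))) =
  expC (- (p * v)) * Q.[p].
Proof.
move=> dv QP; pose w (t : R) : C := p + t%:C * d.
have dw t : is_cder w t d.
  apply: is_cder_eq (is_cderD (is_cder_cst p t) (is_cderM (is_cder_id t) (is_cder_cst d t))) _.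
  by rewrite mulr0 !add0r mul1r.
have dwv t : is_cder (fun t => - (w t * v)) t (- (d * v)).
  apply: is_cderN; apply: is_cder_eq (is_cderM (dw t) (is_cder_cst v t)) _.
  by rewrite mulr0 add0r.
have dprod (S : {poly C}) t : is_cder (fun t => S.[w t] * expC (- (w t * v))) t
    (d * ((deriv S - v *: S).[w t] * expC (- (w t * v)))).
  apply: is_cder_eq (is_cderM (is_cder_horner S (dw t)) (is_cder_exp (dwv t))) _.
  by rewrite hornerD hornerN hornerZ; ring.
pose F t := - (Q.[w t] * expC (- (w t * v))).
pose f t := d * (P.[w t] * expC (- (w t * v))).
have dF t : is_cder F t (f t).
  apply: is_cder_eq (is_cderN (dprod Q t)) _; by rewrite /f -QP !(hornerD, hornerN, hornerZ); ring.
have df t : is_cder f t (d * (d * ((deriv P - v *: P).[w t] * expC (- (w t * v))))).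
  exact: is_cderZ.
pose c := Re (d * v) / 2; have c0 : 0 < c by rewrite divr_gt0.
have [K hK] := horner_exp_decay P p dv; have [L hL] := horner_exp_decay Q p dv.
have fK t : 0 <= t -> normc (f t) <= normc d * K * expR (- (c * t)).
  by move=> t0; rewrite normcM -mulrA ler_wpM2l ?normc_ge0 //; apply: hK.
have FL t : 0 <= t -> normc (F t) <= L * expR (- (c * t)).
  by move=> t0; rewrite normcNE; apply: hL.
have Fy (k : C -> R) : (forall z, `|k z| <= normc z) -> k (F t) @[t --> +oo] --> 0.
  move=> kn; apply: norm_cvg0.
  apply: (@squeeze_cvgr _ _ _ _ (fun=> 0) (fun t => L * expR (- (c * t)))).
  - near=> t; rewrite normr_ge0 /=; apply: le_trans (kn _) (FL _ _).
    by near: t; apply: nbhs_pinfty_ge; rewrite num_real.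
  - exact: cvg_cst.
  - exact: cvg_expR_decay.
(* Stated for a functional [k] dominated by the modulus, to be used once for the real and once for
   the imaginary part. *)
have H (k : C -> R) : (forall z, `|k z| <= normc z) ->
    (forall t : R, is_derive t 1 (fun t => k (F t)) (k (f t))) ->
    continuous (fun t => k (f t)) ->
    Rintegral mu Iy (fun t => k (f t)) = - k (F 0).
  move=> kn dk ck; apply: (@FTCy_decay (fun t => k (F t)) _ c (normc d * K)) => //.
  - by move=> t t0; apply: le_trans (kn _) (fK _ t0).
  - exact: Fy.
have w0 : w 0 = p by rewrite /w mul0r addr0.
have cR : continuous (fun t => Re (f t)).
  move=> t; have [[dt _] _] := df t.
  exact: (differentiable_continuous (proj1 (derivable1_diffP _ _) dt)).
have cI : continuous (fun t => Im (f t)).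
  move=> t; have [_ [dt _]] := df t.
  exact: (differentiable_continuous (proj1 (derivable1_diffP _ _) dt)).
rewrite /cint (H Re (@Re_normc R) (fun t => (dF t).1) cR).
rewrite (H Im (@Im_normc R) (fun t => (dF t).2) cI) /F w0 [RHS]mulrC.
by case: (Q.[p] * expC _) => a b /=; rewrite !opprK.
Unshelve. all: by end_near. Qed.

End RayIntegral.

Lemma double_intE (R : realType) (N : nat) (l : 'I_N -> R) (p d : R[i]) (g : R -> R[i])
    (u v : R[i]) :
  v != 0 -> d != 0 -> 0 < complex.Re (d * v) -> admissible_contour l p d g ->
  double_int l p d g u v = expC (- (p * v)) * (antider v^-1 N (einterp l u)).[p].
Proof.
move=> v0 d0 dv [gl gne gray gw].
set om := (2 * pi)%:C * 'i in gw *.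
have om0 : om != 0.
  rewrite mulf_neq0 //; first by rewrite (inj_eq (@complexI R)) mulf_neq0 // gt_eqF // pi_gt0.
  by rewrite eq_complex /= oner_eq0 andbF.
(* The interpolant at N nodes has degree below N, so N terms of [antider] invert P -> v P - P' on
   it. *)
have sz : (size (einterp l u) <= N)%N.
  apply: leq_trans (size_sum _ _ _) _; apply/bigmax_leqP => q _.
  by apply: leq_trans (size_scale_leq _ _) _; rewrite size_newtonP.
rewrite -(cint_ray p dv (antiderP (mulfV v0) sz)).
apply: cint_eq => t; rewrite /= in_itv /= andbT => t0; congr (d * _).
rewrite (contour_einterp gl u v d0 (om := om)) ?mulKf //.
  move=> i; split; last exact: gw.
  by move=> s Is; apply: gne; apply: mem_set.
(* The ray that starts at w = p + t d is part of the ray from [p], which the loop avoids. *)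
move=> s t' Is t'0; rewrite -addrA -mulrDl -rmorphD.
by apply: gray; [exact: mem_set|exact: addr_ge0].
Qed.

Theorem theorem1p7 (R : realType) (N : nat) (l : 'I_N -> R) (p : R[i]) :
  weyl l -> (forall i, p != (l i)%:C) ->
  (forall (k : nat) (u v : 'I_k -> R[i]),
     injective u -> injective v -> (forall i j, u i != v j) ->
     exists r : 'I_k -> 'I_k -> R[i],
       (forall i j, ratio_is l p (with_zeros (N := N) (fun _ : 'I_1 => u i))
                             (fun _ : 'I_1 => v j) (r i j)) /\
       ratio_is l p (with_zeros (N := N) u) v
         ((\prod_(i < k) \prod_(j < k) (u i - v j)) /
          (\prod_(i < k) \prod_(j < k | (i < j)%N) ((u i - u j) * (v j - v i))) *
          \det (\matrix_(i, j) ((u i - v j)^-1 * r i j)))) /\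
  (forall u v : R[i], u != 0 -> v != 0 -> u != v ->
     forall (d : R[i]) (g : R -> R[i]),
       d != 0 -> 0 < complex.Re (d * v) -> admissible_contour l p d g ->
       ratio_is l p (with_zeros (N := N) (fun _ : 'I_1 => u)) (fun _ : 'I_1 => v)
         ((u - v) * (v / u) ^+ N *
          (expC (p * (u - v)) / (u - v) + double_int l p d g u v))).
Proof.
move=> _ _; split=> [k u v ui vi uv|u v u0 v0 uv d g d0 dv adm].
  (* The same closed expression [rat] serves as the k = 1 ratio in both halves of the statement. *)
  exists (fun i j => rat p (u i) (v j) l); split=> [i j|]; first exact: rat_ratio_is.
  exact: ratk_ratio_is.
suff <- : rat p u v l = (u - v) * (v / u) ^+ N *
    (expC (p * (u - v)) / (u - v) + double_int l p d g u v) by exact: rat_ratio_is.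
rewrite ratE // (double_intE _ v0 d0 dv adm).
have uv0 : u - v != 0 by rewrite subr_eq0.
move: ((v / u) ^+ N) (expC _) (expC _) => a b e.
by field.
Qed.
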